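(* The index set $\{ e: \mathcal{C}_e \text{ has degree of bi-embeddable categoricity } \mathbf{0}''\}$ is $\Pi^0_4$-complete.
   Context: An equivalence structure $\mathcal{A}=(A,E)$ has universe $A\subseteq\omega$ and an equivalence relation $E$ on $A$; it is computable if its atomic diagram is computable. Two structures are bi-embeddable if each embeds into the other. The degree of bi-embeddable categoricity of a computable structure $\mathcal{A}$ is the least Turing degree $\mathbf{d}$ (if it exists) such that for any two computable structures bi-embeddable with $\mathcal{A}$, $\mathbf{d}$ computes embeddings between them in both directions. $(\mathcal{C}_e)_{e\in\omega}$ is the enumeration of partial computable equivalence structures: for the $e$-th partial computable function $\phi_e:\omega\times\omega\to\{0,1\}$, $\mathcal{C}_e$ has universe $\omega$ and $x E^{\mathcal{C}_e} y$ iff $\phi_e(x,y)=1$. A set is $\Pi^0_4$-complete if it is $\Pi^0_4$ and every $\Pi^0_4$ set is many-one reducible to it via a computable function. *)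

(* Defs.v *)
From Stdlib Require Import Arith Cantor.

Inductive prog : Type :=
| PZero
| PSucc
| PFst
| PSnd
| PPair (f g : prog)
| PComp (f g : prog)
| POracle
| PRec (f g : prog)
| PMu (f : prog).

Definition pair (x y : nat) : nat := Cantor.to_nat (x, y).
Definition unpair1 (n : nat) : nat := fst (Cantor.of_nat n).
Definition unpair2 (n : nat) : nat := snd (Cantor.of_nat n).

Inductive eval (O : nat -> Prop) : prog -> nat -> nat -> Prop :=
| ev_zero x : eval O PZero x 0
| ev_succ x : eval O PSucc x (S x)
| ev_fst x : eval O PFst x (unpair1 x)
| ev_snd x : eval O PSnd x (unpair2 x)
| ev_pair f g x a b :
    eval O f x a -> eval O g x b -> eval O (PPair f g) x (pair a b)
| ev_comp f g x y z :
    eval O g x y -> eval O f y z -> eval O (PComp f g) x z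
| ev_orc_in x : O x -> eval O POracle x 1
| ev_orc_out x : ~ O x -> eval O POracle x 0
| ev_rec0 f g x y :
    eval O f x y -> eval O (PRec f g) (pair x 0) y
| ev_recS f g x m r y :
    eval O (PRec f g) (pair x m) r ->
    eval O g (pair x (pair m r)) y ->
    eval O (PRec f g) (pair x (S m)) y
| ev_mu f x n :
    eval O f (pair x n) 0 ->
    (forall m, m < n -> exists k, eval O f (pair x m) (S k)) ->
    eval O (PMu f) x n.

(** Goedel numbering of programs (every program receives a code; the
    components of a code [n > 0] are [< n]). *)
Fixpoint decode (fuel n : nat) : prog :=
  match fuel with
  | 0 => PZero
  | S k =>
      let a := unpair1 (n / 9) in
      let b := unpair2 (n / 9) in
      match n mod 9 with
      | 0 => PZero
      | 1 => PSucc
      | 2 => PFst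
      | 3 => PSnd
      | 4 => PPair (decode k a) (decode k b)
      | 5 => PComp (decode k a) (decode k b)
      | 6 => POracle
      | 7 => PRec (decode k a) (decode k b)
      | _ => PMu (decode k a)
      end
  end.

Definition prog_of (e : nat) : prog := decode e e.

Definition phi (O : nat -> Prop) (e x y : nat) : Prop := eval O (prog_of e) x y.
Definition empty_oracle : nat -> Prop := fun _ => False.

Definition computable_in (O : nat -> Prop) (A : nat -> Prop) : Prop :=
  exists p : prog, forall x, (A x -> eval O p x 1) /\ (~ A x -> eval O p x 0).
Definition computable_pred (A : nat -> Prop) : Prop := computable_in empty_oracle A.

Definition turing_le (A B : nat -> Prop) : Prop := computable_in B A.

Definition jump (O : nat -> Prop) : nat -> Prop := fun e => exists y, phi O e e y.
Definition zero_dprime : nat -> Prop := jump (jump empty_oracle).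

Definition computable_fun (f : nat -> nat) : Prop :=
  exists p : prog, forall x, eval empty_oracle p x (f x).
Definition m_reducible (A B : nat -> Prop) : Prop :=
  exists f, computable_fun f /\ forall x, A x <-> B (f x).

Definition Pi04 (S : nat -> Prop) : Prop :=
  exists R : nat -> Prop, computable_pred R /\
    forall x, S x <-> forall a, exists b, forall c, exists d,
        R (pair x (pair a (pair b (pair c d)))).
Definition Pi04_complete (S : nat -> Prop) : Prop :=
  Pi04 S /\ forall T, Pi04 T -> m_reducible T S.

Record eq_struct := EqStruct { univ : nat -> Prop; rel : nat -> nat -> Prop }.

Definition is_equiv_on (U : nat -> Prop) (E : nat -> nat -> Prop) : Prop :=
  (forall x y, E x y -> U x /\ U y) /\
  (forall x, U x -> E x x) /\
  (forall x y, E x y -> E y x) /\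
  (forall x y z, E x y -> E y z -> E x z).

Definition computable_eq_struct (A : eq_struct) : Prop :=
  is_equiv_on (univ A) (rel A) /\
  computable_pred (univ A) /\
  computable_pred (fun n => rel A (unpair1 n) (unpair2 n)).

Definition embedding (A B : eq_struct) (f : nat -> nat) : Prop :=
  (forall x, univ A x -> univ B (f x)) /\
  (forall x y, univ A x -> univ A y -> f x = f y -> x = y) /\
  (forall x y, univ A x -> univ A y -> (rel A x y <-> rel B (f x) (f y))).

Definition embeds (A B : eq_struct) : Prop := exists f, embedding A B f.
Definition bi_embeddable (A B : eq_struct) : Prop := embeds A B /\ embeds B A.

Definition computes_embedding (D : nat -> Prop) (A B : eq_struct) : Prop :=
  exists (p : prog) (f : nat -> nat), embedding A B f /\
    forall x, univ A x -> eval D p x (f x).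

Definition bi_emb_cat_oracle (A : eq_struct) (D : nat -> Prop) : Prop :=
  forall B C, computable_eq_struct B -> computable_eq_struct C ->
    bi_embeddable B A -> bi_embeddable C A ->
    computes_embedding D B C /\ computes_embedding D C B.

Definition degree_bi_emb_cat (A : eq_struct) (D : nat -> Prop) : Prop :=
  bi_emb_cat_oracle A D /\
  forall D', bi_emb_cat_oracle A D' -> turing_le D D'.

Definition C_ (e : nat) : eq_struct :=
  EqStruct (fun _ => True) (fun x y => phi empty_oracle e (pair x y) 1).

Definition index_set : nat -> Prop :=
  fun e =>
    (forall x y, phi empty_oracle e (pair x y) 0 \/ phi empty_oracle e (pair x y) 1) /\
    computable_eq_struct (C_ e) /\ degree_bi_emb_cat (C_ e) zero_dprime.

(* Main.v *)
(** An equivalence structure with infinitely many infinite classes has degree 0'':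
    computing an embedding into such a structure needs only to recognise infinite
    classes (a [Pi_2] question), and the structure can be chosen so that any infinite
    list of its infinite classes computes 0''.  With finitely many infinite classes, 0'
    suffices: all but finitely many classes of the source are finite and have infinitely
    many classes of at least their size in the target, so a greedy search succeeds,
    and 0'' is not computable from 0'.  Hence the index set consists of the indices of
    computable structures with infinitely many infinite classes, which is [Pi_4].

    For hardness, turn [forall a, exists b, forall c, exists d, R] into
    [forall a, exists! v, Q a v] with [Q] in [Pi_2], and use a class for each pair
    [<n, s>] which is infinite iff [Q i (s i)] for all [i < n].  Each [n] has at most one
    infinite class, and infinitely many occur iff the formula holds.  The same
    construction, applied to [forall e, exists v, (v = 0 and e is not in 0'') or
    (v > 0 codes a Sigma_2-witness of e in 0'')], yields the structure whose infinite
    classes compute 0''. *)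

From Stdlib Require Import Arith Cantor Lia Classical ClassicalEpsilon.
From Stdlib Require Import FunctionalExtensionality PropExtensionality.
Require Import Defs.

(** * Pairing of natural numbers *)

Lemma unpair1_pair x y : unpair1 (pair x y) = x.
Proof. unfold unpair1, pair. now rewrite cancel_of_to. Qed.

Lemma unpair2_pair x y : unpair2 (pair x y) = y.
Proof. unfold unpair2, pair. now rewrite cancel_of_to. Qed.

Lemma pair_unpair n : pair (unpair1 n) (unpair2 n) = n.
Proof.
  unfold unpair1, unpair2, pair. rewrite <- surjective_pairing.
  apply cancel_to_of.
Qed.

Lemma pair_inj a b c d : pair a b = pair c d -> a = c /\ b = d.
Proof.
  intros H. split.
  - rewrite <- (unpair1_pair a b), H. apply unpair1_pair.
  - rewrite <- (unpair2_pair a b), H. apply unpair2_pair.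
Qed.

Lemma pair_ge x y : x <= pair x y /\ y <= pair x y.
Proof. unfold pair. pose proof (to_nat_non_decreasing x y). lia. Qed.

Lemma unpair_le n : unpair1 n <= n /\ unpair2 n <= n.
Proof. pose proof (pair_ge (unpair1 n) (unpair2 n)). now rewrite pair_unpair in *. Qed.

Opaque pair unpair1 unpair2.

Ltac unpairs :=
  cbv beta in *;
  repeat (rewrite unpair1_pair in * || rewrite unpair2_pair in * ||
          rewrite pair_unpair in *).

(** * Evaluation *)

(** The constructors fix the shape [pair x m] of the argument; for an arbitrary [z] the recursion
    equations can be used by induction on [unpair2 z]. *)
Lemma eval_rec_iff O f g z y :
  eval O (PRec f g) z y <->
  match unpair2 z with
  | 0 => eval O f (unpair1 z) y
  | S m => exists r, eval O (PRec f g) (pair (unpair1 z) m) r /\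
                     eval O g (pair (unpair1 z) (pair m r)) y
  end.
Proof.
  split.
  - intros H. inversion H; subst; unpairs; eauto.
  - intros H. rewrite <- (pair_unpair z).
    destruct (unpair2 z) as [|m]; [now constructor|].
    destruct H as (r & H1 & H2). econstructor; eauto.
Qed.

Lemma eval_det O p : forall x y y', eval O p x y -> eval O p x y' -> y = y'.
Proof.
  induction p; intros x y y' H H'.
  1-4: inversion H; inversion H'; subst; congruence.
  - inversion H; inversion H'; subst. f_equal; eauto.
  - inversion H; inversion H'; subst.
    assert (y0 = y1) by eauto. subst. eauto.
  - inversion H; inversion H'; subst; tauto || congruence.
  - rewrite <- (pair_unpair x) in H, H'.
    revert y y' H H'. induction (unpair2 x) as [|m IHm]; intros y y' H H';
      apply eval_rec_iff in H, H'; unpairs.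
    + eauto.
    + destruct H as (r & H1 & H2), H' as (r' & H1' & H2').
      assert (r = r') by eauto. subst. eauto.
  - inversion H as [| | | | | | | | | |? ? ? H1 H2]; subst.
    inversion H' as [| | | | | | | | | |? ? ? H1' H2']; subst.
    (* At the smaller of two distinct results the body would have value 0 by one derivation and a
       successor by the other. *)
    destruct (lt_eq_lt_dec y y') as [[Hlt|]|Hlt]; trivial.
    + destruct (H2' _ Hlt) as [k Hk]. specialize (IHp _ _ _ H1 Hk). discriminate.
    + destruct (H2 _ Hlt) as [k Hk]. specialize (IHp _ _ _ H1' Hk). discriminate.
Qed.

(** * Total recursive functions and decidable predicates *)

(** Restricted to total functions, so that the closure lemmas need no convergence arguments; for
    [empty_oracle] this is [computable_fun]. *)
Definition recursive_in (O : nat -> Prop) (f : nat -> nat) : Prop :=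
  exists p, forall x, eval O p x (f x).

Definition chi (P : Prop) : nat := if excluded_middle_informative P then 1 else 0.

Lemma chi_true (P : Prop) : P -> chi P = 1.
Proof. intros H. unfold chi. destruct excluded_middle_informative; tauto. Qed.

Lemma chi_false (P : Prop) : ~ P -> chi P = 0.
Proof. intros H. unfold chi. destruct excluded_middle_informative; tauto. Qed.

Lemma chi_cases (P : Prop) : P /\ chi P = 1 \/ ~ P /\ chi P = 0.
Proof. unfold chi. destruct excluded_middle_informative; tauto. Qed.

Lemma least_witness (P : nat -> Prop) :
  (exists n, P n) -> exists n, P n /\ forall m, m < n -> ~ P m.
Proof.
  intros [n Hn]. induction n as [n IH] using lt_wf_ind.
  destruct (classic (exists m, m < n /\ P m)) as [(m & Hm & HPm)|H]; eauto.
  exists n. split; trivial. intros m Hm HPm. eauto.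
Qed.

Section Closure.
Context {O : nat -> Prop}.

Lemma rec_ext f g : recursive_in O f -> (forall x, f x = g x) -> recursive_in O g.
Proof. intros [p H] E. exists p. intros x. rewrite <- E. apply H. Qed.

Lemma dec_ext A B : computable_in O A -> (forall x, A x <-> B x) -> computable_in O B.
Proof. intros [p H] E. exists p. intros x. rewrite <- E. apply H. Qed.

Lemma dec_chi A : computable_in O A <-> recursive_in O (fun x => chi (A x)).
Proof.
  split; intros [p H]; exists p; intros x; specialize (H x).
  - destruct (chi_cases (A x)) as [[? ->]|[? ->]]; tauto.
  - destruct (chi_cases (A x)) as [[? E]|[? E]]; rewrite E in H; tauto.
Qed.

Lemma rec_comp f g :
  recursive_in O g -> recursive_in O f -> recursive_in O (fun x => g (f x)).
Proof. intros [p H] [q H']. exists (PComp p q). intros x. econstructor; eauto. Qed.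

Lemma dec_comp A f :
  computable_in O A -> recursive_in O f -> computable_in O (fun x => A (f x)).
Proof.
  rewrite !dec_chi. intros HA Hf. exact (rec_comp f (fun y => chi (A y)) HA Hf).
Qed.

Lemma rec_id : recursive_in O (fun x => x).
Proof.
  exists (PPair PFst PSnd). intros x. rewrite <- (pair_unpair x) at 2.
  repeat constructor.
Qed.

Lemma rec_S f : recursive_in O f -> recursive_in O (fun x => S (f x)).
Proof. apply (rec_comp f S). exists PSucc. constructor. Qed.

Lemma rec_unpair1 f : recursive_in O f -> recursive_in O (fun x => unpair1 (f x)).
Proof. apply (rec_comp f unpair1). exists PFst. constructor. Qed.

Lemma rec_unpair2 f : recursive_in O f -> recursive_in O (fun x => unpair2 (f x)).
Proof. apply (rec_comp f unpair2). exists PSnd. constructor. Qed.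

Lemma rec_pair f g :
  recursive_in O f -> recursive_in O g -> recursive_in O (fun x => pair (f x) (g x)).
Proof. intros [p H] [q H']. exists (PPair p q). constructor; auto. Qed.

Lemma rec_const c : recursive_in O (fun _ => c).
Proof.
  induction c as [|c IH]; [exists PZero; constructor|]. now apply rec_S.
Qed.

Lemma rec_nat_rect i n G :
  recursive_in O i -> recursive_in O n ->
  recursive_in O (fun z => G (unpair1 z) (unpair1 (unpair2 z)) (unpair2 (unpair2 z))) ->
  recursive_in O (fun x => nat_rect (fun _ => nat) (i x) (G x) (n x)).
Proof.
  intros [p Hp] Hn [q Hq].
  (* The parameter [x] travels along as the first component of the argument of [PRec], so [i], [n]
     and [G] may all depend on it. *)
  apply rec_ext with (fun x => (fun z => nat_rect (fun _ => nat) (i (unpair1 z))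
    (G (unpair1 z)) (unpair2 z)) (pair x (n x))).
  - apply (rec_comp (fun x => pair x (n x))
      (fun z => nat_rect (fun _ => nat) (i (unpair1 z)) (G (unpair1 z)) (unpair2 z))).
    2: now apply rec_pair; [apply rec_id|].
    exists (PRec p q). intros z. rewrite <- (pair_unpair z) at 1.
    induction (unpair2 z) as [|m IH]; cbn.
    + now constructor.
    + econstructor; [exact IH|].
      match goal with |- eval _ _ ?w _ => specialize (Hq w) end.
      now unpairs.
  - intros x. now unpairs.
Qed.

Lemma rec_iter n F i :
  recursive_in O n -> recursive_in O i ->
  recursive_in O (fun z => F (unpair1 z) (unpair2 z)) ->
  recursive_in O (fun x => Nat.iter (n x) (F x) (i x)).
Proof.
  intros Hn Hi HF.
  apply rec_ext with (fun x => nat_rect (fun _ => nat) (i x) (fun _ r => F x r) (n x)).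
  - apply (rec_nat_rect i n (fun x _ r => F x r)); trivial.
    apply rec_ext with
      (fun z => (fun w => F (unpair1 w) (unpair2 w))
                  (pair (unpair1 z) (unpair2 (unpair2 z)))).
    + apply (rec_comp _ (fun w => F (unpair1 w) (unpair2 w))); trivial.
      apply rec_pair.
      * apply rec_unpair1, rec_id.
      * apply rec_unpair2, rec_unpair2, rec_id.
    + intros z. now unpairs.
  - intros x. reflexivity.
Qed.

Lemma rec_add f g :
  recursive_in O f -> recursive_in O g -> recursive_in O (fun x => f x + g x).
Proof.
  intros Hf Hg. apply rec_ext with (fun x => Nat.iter (f x) S (g x)).
  - apply (rec_iter f (fun _ => S) g); trivial. apply rec_S, rec_unpair2, rec_id.
  - intros x. unfold Nat.iter. induction (f x) as [|m IH]; cbn; lia.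
Qed.

Lemma rec_mul f g :
  recursive_in O f -> recursive_in O g -> recursive_in O (fun x => f x * g x).
Proof.
  intros Hf Hg. apply rec_ext with (fun x => Nat.iter (f x) (fun r => g x + r) 0).
  - apply (rec_iter f (fun x r => g x + r) (fun _ => 0)); trivial.
    + apply rec_const.
    + apply rec_add; [|apply rec_unpair2, rec_id].
      apply (rec_comp unpair1 g); trivial. apply rec_unpair1, rec_id.
  - intros x. unfold Nat.iter. induction (f x) as [|m IH]; cbn; lia.
Qed.

Lemma rec_pred f : recursive_in O f -> recursive_in O (fun x => pred (f x)).
Proof.
  intros Hf.
  apply rec_ext with (fun x => nat_rect (fun _ => nat) 0 (fun m _ => m) (f x)).
  - apply (rec_nat_rect (fun _ => 0) f (fun _ m _ => m)); trivial.
    + apply rec_const.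
    + apply rec_unpair1, rec_unpair2, rec_id.
  - intros x. now destruct (f x).
Qed.

Lemma rec_sub f g :
  recursive_in O f -> recursive_in O g -> recursive_in O (fun x => f x - g x).
Proof.
  intros Hf Hg. apply rec_ext with (fun x => Nat.iter (g x) pred (f x)).
  - apply (rec_iter g (fun _ => pred) f); trivial. apply rec_pred, rec_unpair2, rec_id.
  - intros x. unfold Nat.iter. induction (g x) as [|m IH]; cbn; lia.
Qed.

Lemma dec_zero f : recursive_in O f -> computable_in O (fun x => f x = 0).
Proof.
  intros Hf. apply dec_chi. apply rec_ext with (fun x => 1 - f x).
  - apply rec_sub; [apply rec_const|trivial].
  - intros x. destruct (chi_cases (f x = 0)) as [[? ->]|[? ->]]; lia.
Qed.

Lemma dec_le f g :
  recursive_in O f -> recursive_in O g -> computable_in O (fun x => f x <= g x).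
Proof.
  intros Hf Hg. apply dec_ext with (fun x => f x - g x = 0).
  - now apply dec_zero, rec_sub.
  - intros x. lia.
Qed.

Lemma dec_lt f g :
  recursive_in O f -> recursive_in O g -> computable_in O (fun x => f x < g x).
Proof. intros Hf Hg. apply (dec_le (fun x => S (f x)) g); trivial. now apply rec_S. Qed.

Lemma dec_not A : computable_in O A -> computable_in O (fun x => ~ A x).
Proof.
  intros HA. apply dec_chi in HA. apply dec_ext with (fun x => chi (A x) = 0).
  - now apply dec_zero.
  - intros x. destruct (chi_cases (A x)) as [[? ->]|[? ->]]; split; tauto || discriminate.
Qed.

Lemma dec_and A B :
  computable_in O A -> computable_in O B -> computable_in O (fun x => A x /\ B x).
Proof.
  intros HA%dec_not%dec_chi HB%dec_not%dec_chi.
  apply dec_ext with (fun x => chi (~ A x) + chi (~ B x) = 0).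
  - now apply dec_zero, rec_add.
  - intros x. destruct (chi_cases (~ A x)) as [[? ->]|[? ->]];
      destruct (chi_cases (~ B x)) as [[? ->]|[? ->]]; split; try tauto; lia.
Qed.

Lemma dec_or A B :
  computable_in O A -> computable_in O B -> computable_in O (fun x => A x \/ B x).
Proof.
  intros HA HB. apply dec_ext with (fun x => ~ (~ A x /\ ~ B x)).
  - now apply dec_not, dec_and; apply dec_not.
  - intros x. tauto.
Qed.

Lemma dec_imp A B :
  computable_in O A -> computable_in O B -> computable_in O (fun x => A x -> B x).
Proof.
  intros HA HB. apply dec_ext with (fun x => ~ A x \/ B x).
  - now apply dec_or; [apply dec_not|].
  - intros x. tauto.
Qed.

Lemma dec_eq f g :
  recursive_in O f -> recursive_in O g -> computable_in O (fun x => f x = g x).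
Proof.
  intros Hf Hg. apply dec_ext with (fun x => f x <= g x /\ g x <= f x).
  - now apply dec_and; apply dec_le.
  - intros x. lia.
Qed.

Lemma dec_true : computable_in O (fun _ => True).
Proof. exists (PComp PSucc PZero). intros x. split; [|tauto]. repeat econstructor. Qed.

Lemma dec_ball b P :
  recursive_in O b -> computable_in O (fun z => P (unpair1 z) (unpair2 z)) ->
  computable_in O (fun x => forall y, y < b x -> P x y).
Proof.
  intros Hb HP. apply dec_not, dec_chi in HP.
  apply dec_ext with
    (fun x => nat_rect (fun _ => nat) 0 (fun m r => chi (~ P x m) + r) (b x) = 0).
  - apply dec_zero, (rec_nat_rect (fun _ => 0) b (fun x m r => chi (~ P x m) + r)); trivial.
    + apply rec_const.
    + apply rec_add; [|apply rec_unpair2, rec_unpair2, rec_id].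
      apply rec_ext with (fun z => (fun w => chi (~ P (unpair1 w) (unpair2 w)))
        (pair (unpair1 z) (unpair1 (unpair2 z)))).
      * apply (rec_comp _ (fun w => chi (~ P (unpair1 w) (unpair2 w)))); trivial.
        apply rec_pair; [|apply rec_unpair1, rec_unpair2, rec_id].
        apply rec_unpair1, rec_id.
      * intros z. now unpairs.
  - intros x. induction (b x) as [|m IH]; cbn [nat_rect].
    + split; trivial. lia.
    + destruct (chi_cases (~ P x m)) as [[H ->]|[H ->]]; cbn.
      * split; [discriminate|]. intros H'. destruct H. apply H'. lia.
      * rewrite IH. apply NNPP in H. split.
        -- intros H' y Hy. destruct (Nat.eq_dec y m); subst; trivial.
           apply H'. lia.
        -- intros H' y Hy. apply H'. lia.
Qed.

Lemma dec_bex b P :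
  recursive_in O b -> computable_in O (fun z => P (unpair1 z) (unpair2 z)) ->
  computable_in O (fun x => exists y, y < b x /\ P x y).
Proof.
  intros Hb HP. apply dec_ext with (fun x => ~ forall y, y < b x -> ~ P x y).
  - now apply dec_not, (dec_ball b (fun x y => ~ P x y)), dec_not.
  - intros x. split.
    + intros H. apply NNPP. intros H'. apply H. intros y Hy HPy. apply H'. eauto.
    + intros (y & Hy & HPy) H. exact (H y Hy HPy).
Qed.

(** The decider of [~ P] returns 0 exactly at the witnesses, so [PMu] applied to it finds the least
    one. *)
Lemma rec_mu P :
  computable_in O (fun z => P (unpair1 z) (unpair2 z)) ->
  (forall x, exists y, P x y) ->
  exists f, recursive_in O f /\
    forall x, P x (f x) /\ forall y, y < f x -> ~ P x y.
Proof.
  intros HP%dec_not%dec_chi Hex.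
  assert (Hmin : forall x, exists y, P x y /\ forall z, z < y -> ~ P x z).
  { intros x. apply least_witness, Hex. }
  exists (fun x => proj1_sig (constructive_indefinite_description _ (Hmin x))).
  split.
  - destruct HP as [p Hp]. exists (PMu p). intros x.
    destruct (constructive_indefinite_description _ (Hmin x)) as (y & Hy & Hlt); cbn.
    constructor.
    + specialize (Hp (pair x y)). cbn in Hp. unpairs.
      now rewrite (chi_false (~ P x y)) in Hp by tauto.
    + intros m Hm. exists 0. specialize (Hp (pair x m)). cbn in Hp. unpairs.
      now rewrite (chi_true (~ P x m)) in Hp by auto.
  - intros x. now destruct (constructive_indefinite_description _ (Hmin x)).
Qed.

(** A total function is computed by searching its decidable graph for the value. *)
Lemma rec_graph f :
  computable_in O (fun z => f (unpair1 z) = unpair2 z) -> recursive_in O f.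
Proof.
  intros H. destruct (rec_mu (fun x y => f x = y) H) as (g & Hg & Hfg); eauto.
  apply rec_ext with g; trivial. intros x. symmetry. apply Hfg.
Qed.

Lemma rec_if A f g h :
  computable_in O A -> recursive_in O f -> recursive_in O g ->
  (forall x, A x -> h x = f x) -> (forall x, ~ A x -> h x = g x) ->
  recursive_in O h.
Proof.
  intros HA%dec_chi Hf Hg H1 H2.
  apply rec_ext with (fun x => chi (A x) * f x + (1 - chi (A x)) * g x).
  - apply rec_add; apply rec_mul; trivial. apply rec_sub; trivial. apply rec_const.
  - intros x. destruct (chi_cases (A x)) as [[H ->]|[H ->]].
    + rewrite H1 by trivial. lia.
    + rewrite H2 by trivial. lia.
Qed.

Lemma rec_eqb_if a b f g :
  recursive_in O a -> recursive_in O b -> recursive_in O f -> recursive_in O g ->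
  recursive_in O (fun x => if a x =? b x then f x else g x).
Proof.
  intros Ha Hb Hf Hg. apply (rec_if (fun x => a x = b x) f g); trivial.
  - now apply dec_eq.
  - intros x ->. now rewrite Nat.eqb_refl.
  - intros x H. now apply Nat.eqb_neq in H as ->.
Qed.

Definition count (P : nat -> Prop) (n : nat) : nat :=
  nat_rect (fun _ => nat) 0 (fun m r => chi (P m) + r) n.

Lemma rec_count b P :
  recursive_in O b -> computable_in O (fun z => P (unpair1 z) (unpair2 z)) ->
  recursive_in O (fun x => count (P x) (b x)).
Proof.
  intros Hb HP. apply dec_chi in HP.
  apply (rec_nat_rect (fun _ => 0) b (fun x m r => chi (P x m) + r)); trivial.
  - apply rec_const.
  - apply rec_add; [|apply rec_unpair2, rec_unpair2, rec_id].
    apply rec_ext with (fun z => (fun w => chi (P (unpair1 w) (unpair2 w)))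
      (pair (unpair1 z) (unpair1 (unpair2 z)))).
    + apply (rec_comp _ (fun w => chi (P (unpair1 w) (unpair2 w)))); trivial.
      apply rec_pair; [|apply rec_unpair1, rec_unpair2, rec_id].
      apply rec_unpair1, rec_id.
    + intros z. now unpairs.
Qed.

(** A finite table is recursive in any oracle, however it was obtained. This later hard-wires
    finitely many classes into an embedding. *)
Lemma rec_finite_support t N :
  (forall x, N <= x -> t x = 0) -> recursive_in O t.
Proof.
  revert t. induction N as [|N IH]; intros t Ht.
  - apply rec_ext with (fun _ => 0); [apply rec_const|].
    intros x. symmetry. apply Ht. lia.
  - apply (rec_if (fun x => x = N) (fun _ => t N)
             (fun x => if x =? N then 0 else t x)).
    + apply dec_eq; [apply rec_id|apply rec_const].
    + apply rec_const.
    + apply IH. intros x Hx. destruct (Nat.eqb_spec x N); trivial. apply Ht. lia.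
    + now intros x ->.
    + intros x H. now apply Nat.eqb_neq in H as ->.
Qed.

Lemma rec_div9 f : recursive_in O f -> recursive_in O (fun x => f x / 9).
Proof.
  apply (rec_comp f (fun x => x / 9)). apply rec_graph.
  apply dec_ext with
    (fun z => 9 * unpair2 z <= unpair1 z /\ unpair1 z < 9 * unpair2 z + 9).
  - apply dec_and.
    + apply dec_le; [|apply rec_unpair1, rec_id].
      apply rec_mul; [apply rec_const|apply rec_unpair2, rec_id].
    + apply dec_lt; [apply rec_unpair1, rec_id|].
      apply rec_add; [|apply rec_const].
      apply rec_mul; [apply rec_const|apply rec_unpair2, rec_id].
  - intros z. pose proof (Nat.div_mod_eq (unpair1 z) 9).
    pose proof (Nat.mod_upper_bound (unpair1 z) 9). lia.
Qed.

Lemma rec_mod9 f : recursive_in O f -> recursive_in O (fun x => f x mod 9).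
Proof.
  intros Hf. apply rec_ext with (fun x => f x - 9 * (f x / 9)).
  - apply rec_sub; trivial. apply rec_mul; [apply rec_const|now apply rec_div9].
  - intros x. pose proof (Nat.div_mod_eq (f x) 9). lia.
Qed.

End Closure.

Ltac rec_step :=
  first
  [ assumption
  | apply rec_const | apply rec_id | apply dec_true
  | apply rec_unpair1 | apply rec_unpair2 | apply rec_pair
  | apply rec_div9 | apply rec_mod9
  | apply rec_mul | apply rec_add | apply rec_sub | apply rec_pred | apply rec_S
  | apply rec_eqb_if
  | apply dec_le | apply dec_lt | apply dec_eq
  | apply dec_and | apply dec_or | apply dec_not
  | apply dec_ball | apply dec_bex | apply dec_imp
  | apply rec_iter | apply rec_count
  | match goal with
    | H : computable_in ?O ?A |- computable_in ?O _ => refine (dec_comp A _ H _)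
    | H : recursive_in ?O ?g |- recursive_in ?O _ => refine (rec_comp _ g H _)
    end ].
Ltac rec_auto := repeat rec_step.

(** * Relativization to an arbitrary oracle *)

Fixpoint erase_oracle (p : prog) : prog :=
  match p with
  | POracle => PZero
  | PPair f g => PPair (erase_oracle f) (erase_oracle g)
  | PComp f g => PComp (erase_oracle f) (erase_oracle g)
  | PRec f g => PRec (erase_oracle f) (erase_oracle g)
  | PMu f => PMu (erase_oracle f)
  | q => q
  end.

(** The empty oracle answers 0 to every query, so [PZero] can stand in for the queries and the
    oracle no longer matters. *)
Lemma eval_erase_oracle O p :
  forall x y, eval empty_oracle p x y -> eval O (erase_oracle p) x y.
Proof.
  induction p; intros x y H; cbn.
  1-4: inversion H; constructor.
  - inversion H; subst. constructor; auto.
  - inversion H; subst. econstructor; eauto.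
  - inversion H as [| | | | | |? HO| | | |]; subst; [destruct HO|constructor].
  - rewrite <- (pair_unpair x) in *. revert y H.
    induction (unpair2 x) as [|m IHm]; intros y H; apply eval_rec_iff in H; unpairs.
    + constructor. auto.
    + destruct H as (r & H1 & H2). econstructor; eauto.
  - inversion H as [| | | | | | | | | |? ? ? H1 H2]; subst. constructor; auto.
    intros m Hm. destruct (H2 m Hm) as [k Hk]. eauto.
Qed.

Lemma rec_relativize {O} f : recursive_in empty_oracle f -> recursive_in O f.
Proof.
  intros [p Hp]. exists (erase_oracle p). intros x. now apply eval_erase_oracle.
Qed.

Lemma dec_relativize {O} A : computable_pred A -> computable_in O A.
Proof. unfold computable_pred. rewrite !dec_chi. apply rec_relativize. Qed.

(** * Goedel numbers *)

Fixpoint code (p : prog) : nat :=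
  match p with
  | PZero => 0
  | PSucc => 1
  | PFst => 2
  | PSnd => 3
  | PPair f g => 4 + 9 * pair (code f) (code g)
  | PComp f g => 5 + 9 * pair (code f) (code g)
  | POracle => 6
  | PRec f g => 7 + 9 * pair (code f) (code g)
  | PMu f => 8 + 9 * pair (code f) 0
  end.

(** Recursive calls go to components of [n / 9], which are below a positive [n], so fuel [n] already
    suffices. *)
Lemma decode_fuel k k' n : n <= k -> n <= k' -> decode k n = decode k' n.
Proof.
  revert k' n. induction k as [|k IH]; intros k' n Hk Hk'.
  - replace n with 0 by lia. now destruct k'.
  - destruct k' as [|k']; [replace n with 0 by lia; reflexivity|].
    destruct n as [|n]; [reflexivity|].
    assert (Hlt : S n / 9 < S n) by (apply Nat.div_lt; lia).
    pose proof (unpair_le (S n / 9)).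
    cbn [decode].
    rewrite (IH k' (unpair1 (S n / 9))), (IH k' (unpair2 (S n / 9))) by lia.
    reflexivity.
Qed.

Lemma prog_of_unfold n :
  prog_of n =
    let a := unpair1 (n / 9) in
    let b := unpair2 (n / 9) in
    match n mod 9 with
    | 0 => PZero
    | 1 => PSucc
    | 2 => PFst
    | 3 => PSnd
    | 4 => PPair (prog_of a) (prog_of b)
    | 5 => PComp (prog_of a) (prog_of b)
    | 6 => POracle
    | 7 => PRec (prog_of a) (prog_of b)
    | _ => PMu (prog_of a)
    end.
Proof.
  destruct n as [|n]; [reflexivity|].
  assert (Hlt : S n / 9 < S n) by (apply Nat.div_lt; lia).
  pose proof (unpair_le (S n / 9)).
  unfold prog_of at 1. cbn [decode].
  rewrite (decode_fuel n (unpair1 (S n / 9)) (unpair1 (S n / 9))) by lia.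
  rewrite (decode_fuel n (unpair2 (S n / 9)) (unpair2 (S n / 9))) by lia.
  reflexivity.
Qed.

Lemma div_mod_9 r q : r < 9 -> (r + 9 * q) / 9 = q /\ (r + 9 * q) mod 9 = r.
Proof.
  intros Hr. rewrite (Nat.mul_comm 9). split.
  - rewrite Nat.div_add, Nat.div_small; lia.
  - rewrite Nat.Div0.mod_add. now apply Nat.mod_small.
Qed.

Lemma prog_of_code p : prog_of (code p) = p.
Proof.
  induction p; try reflexivity; rewrite prog_of_unfold; cbn [code];
    match goal with |- context [(?r + 9 * ?q) / 9] =>
      destruct (div_mod_9 r q) as [-> ->]; [lia|] end;
    cbn; unpairs; congruence.
Qed.

(** Composition with [const_prog x] hard-wires the input [x]; together with the recursiveness of its
    code this plays the role of the s-m-n theorem. *)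
Fixpoint const_prog (n : nat) : prog :=
  match n with
  | 0 => PZero
  | S m => PComp PSucc (const_prog m)
  end.

Lemma eval_const_prog O n x : eval O (const_prog n) x n.
Proof. induction n; cbn; econstructor; eauto. constructor. Qed.

Lemma rec_code_const_prog {O} : recursive_in O (fun n => code (const_prog n)).
Proof.
  apply rec_ext with (fun n => Nat.iter n (fun r => 5 + 9 * pair 1 r) 0).
  - apply (rec_iter (fun n => n) (fun _ r => 5 + 9 * pair 1 r)); rec_auto.
  - intros n. unfold Nat.iter.
    induction n as [|n IH]; cbn [nat_rect code const_prog]; [reflexivity|].
    now rewrite <- IH.
Qed.

(** * The Turing jump *)

Lemma jump_code O p : jump O (code p) <-> exists y, eval O p (code p) y.
Proof. unfold jump, phi. now rewrite prog_of_code. Qed.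

(** The search for a witness, with [x] hard-wired, halts iff a witness exists. It ignores its own
    argument, so the self-application in [jump] is harmless. *)
Lemma dec_exists_jump O P :
  computable_in O (fun z => P (unpair1 z) (unpair2 z)) ->
  computable_in (jump O) (fun x => exists y, P x y).
Proof.
  intros HP%dec_not%dec_chi. destruct HP as [p Hp].
  set (q := fun x => PComp (PMu p) (const_prog x)).
  assert (Hq : forall x, jump O (code (q x)) <-> exists y, P x y).
  { intros x. rewrite jump_code. unfold q. split.
    - intros [y Hy]. inversion Hy as [| | | | |? ? ? c ? Hc Hm| | | | |]; subst.
      assert (c = x) by (eapply eval_det; [apply Hc|apply eval_const_prog]). subst c.
      inversion Hm as [| | | | | | | | | |? ? ? H1 H2]; subst.
      exists y. specialize (Hp (pair x y)).
      pose proof (eval_det _ _ _ _ _ H1 Hp) as E. cbn in E. unpairs.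
      destruct (chi_cases (~ P x y)) as [[? E']|[? ?]]; [congruence|tauto].
    - intros Hex.
      apply least_witness in Hex as (y & Hy & Hlt). exists y.
      econstructor; [apply eval_const_prog|]. constructor.
      + specialize (Hp (pair x y)). cbn in Hp. unpairs.
        now rewrite (chi_false (~ P x y)) in Hp by tauto.
      + intros m Hm. exists 0. specialize (Hp (pair x m)). cbn in Hp. unpairs.
        now rewrite (chi_true (~ P x m)) in Hp by auto. }
  apply dec_ext with (fun x => jump O (code (q x))); trivial.
  apply (dec_comp (jump O) (fun x => code (q x))).
  - exists POracle. split; now constructor.
  - apply (rec_add (fun _ => 5)
      (fun x => 9 * pair (code (PMu p)) (code (const_prog x)))); rec_auto.
    apply rec_code_const_prog.
Qed.

(** Diagonalization: [q] halts at an argument iff [p] returns 0 there, which contradicts the choice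
    of [p] at the argument [code q]. *)
Lemma jump_not_le O : ~ turing_le (jump O) O.
Proof.
  intros [p Hp].
  set (q := PMu (PComp p PFst)).
  assert (Hq : (exists y, eval O q (code q) y) <-> ~ jump O (code q)).
  { split.
    - intros [y Hy] Hj. apply Hp in Hj.
      inversion Hy as [| | | | | | | | | |? ? ? H1 H2]; subst.
      inversion H1 as [| | | | |? ? ? c ? Hc Hm| | | | |]; subst.
      inversion Hc; subst. unpairs. pose proof (eval_det _ _ _ _ _ Hj Hm). discriminate.
    - intros Hj. apply Hp in Hj. exists 0. constructor; [|lia].
      econstructor; [constructor|]. now unpairs. }
  rewrite <- jump_code in Hq. tauto.
Qed.

(** * A universal machine *)

(* A state is either [ev c x k] (evaluate the program coded by [c] at [x], then
   continue with the stack [k]) or [ret v k] (return [v] to [k]). *)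
Definition ev (c x k : nat) : nat := pair (S c) (pair x k).
Definition ret (v k : nat) : nat := pair 0 (pair v k).
(** The empty stack is 0; the successor keeps every nonempty stack apart from it. *)
Definition push (tag d k : nat) : nat := S (pair (pair tag d) k).

(** What to do with a returned value [v]. Tag 0: start the second component of a pair. Tag 1: form
    the pair. Tag 2: apply the outer function of a composition. Tag 3: apply the step function of a
    recursion. Tag 4: end a search, or try the next candidate. *)
Definition frame_step (tag d v k : nat) : nat :=
  if tag =? 0 then ev (unpair1 d) (unpair2 d) (push 1 v k)
  else if tag =? 1 then ret (pair d v) k
  else if tag =? 2 then ev d v k
  else if tag =? 3 then
    ev (unpair1 d) (pair (unpair1 (unpair2 d)) (pair (unpair2 (unpair2 d)) v)) k
  else if v =? 0 then ret (unpair2 (unpair2 d)) k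
  else ev (unpair1 d) (pair (unpair1 (unpair2 d)) (S (unpair2 (unpair2 d))))
         (push 4 (pair (unpair1 d) (pair (unpair1 (unpair2 d)) (S (unpair2 (unpair2 d))))) k).

Definition eval_step (a c x k : nat) : nat :=
  if c mod 9 =? 0 then ret 0 k
  else if c mod 9 =? 1 then ret (S x) k
  else if c mod 9 =? 2 then ret (unpair1 x) k
  else if c mod 9 =? 3 then ret (unpair2 x) k
  else if c mod 9 =? 4 then
    ev (unpair1 (c / 9)) x (push 0 (pair (unpair2 (c / 9)) x) k)
  else if c mod 9 =? 5 then
    ev (unpair2 (c / 9)) x (push 2 (unpair1 (c / 9)) k)
  else if c mod 9 =? 6 then ret a k
  else if c mod 9 =? 7 then
    if unpair2 x =? 0 then ev (unpair1 (c / 9)) (unpair1 x) k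
    else ev c (pair (unpair1 x) (pred (unpair2 x)))
           (push 3 (pair (unpair2 (c / 9)) (pair (unpair1 x) (pred (unpair2 x)))) k)
  else ev (unpair1 (c / 9)) (pair x 0)
         (push 4 (pair (unpair1 (c / 9)) (pair x 0)) k).

Definition step (a st : nat) : nat :=
  if unpair1 st =? 0 then
    if unpair2 (unpair2 st) =? 0 then st
    else frame_step (unpair1 (unpair1 (pred (unpair2 (unpair2 st)))))
           (unpair2 (unpair1 (pred (unpair2 (unpair2 st)))))
           (unpair1 (unpair2 st)) (unpair2 (pred (unpair2 (unpair2 st))))
  else eval_step a (pred (unpair1 st)) (unpair1 (unpair2 st)) (unpair2 (unpair2 st)).

(** One step can query the oracle only at its current argument, so a single answer is supplied. As
    [ans] is any function, approximations to an oracle can be plugged in. *)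
Definition oracle_step (ans : nat -> nat) (st : nat) : nat :=
  step (ans (unpair1 (unpair2 st))) st.

Definition run (ans : nat -> nat) (t st : nat) : nat := Nat.iter t (oracle_step ans) st.

Definition halted (st : nat) : Prop := unpair1 st = 0 /\ unpair2 (unpair2 st) = 0.

Section ComputableRun.
Context {O : nat -> Prop}.

Lemma rec_ev f g h :
  recursive_in O f -> recursive_in O g -> recursive_in O h ->
  recursive_in O (fun x => ev (f x) (g x) (h x)).
Proof. intros. unfold ev. rec_auto. Qed.

Lemma rec_ret f g :
  recursive_in O f -> recursive_in O g -> recursive_in O (fun x => ret (f x) (g x)).
Proof. intros. unfold ret. rec_auto. Qed.

Lemma rec_push f g h :
  recursive_in O f -> recursive_in O g -> recursive_in O h ->
  recursive_in O (fun x => push (f x) (g x) (h x)).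
Proof. intros. unfold push. rec_auto. Qed.

Lemma rec_oracle_step ans :
  recursive_in O (fun z => ans (unpair1 z) (unpair2 z)) ->
  recursive_in O (fun z => oracle_step (ans (unpair1 z)) (unpair2 z)).
Proof.
  intros Hans.
  assert (Hans' : recursive_in O
    (fun z => ans (unpair1 z) (unpair1 (unpair2 (unpair2 z))))).
  { apply rec_ext with (fun z => (fun w => ans (unpair1 w) (unpair2 w))
      (pair (unpair1 z) (unpair1 (unpair2 (unpair2 z))))).
    - apply (rec_comp (fun z => pair (unpair1 z) (unpair1 (unpair2 (unpair2 z))))
        (fun w => ans (unpair1 w) (unpair2 w))); rec_auto.
    - intros z. now unpairs. }
  unfold oracle_step, step, frame_step, eval_step.
  repeat first [apply rec_ev | apply rec_ret | apply rec_push | rec_step].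
Qed.

Lemma rec_run ans t st :
  recursive_in O (fun z => ans (unpair1 z) (unpair2 z)) ->
  recursive_in O t -> recursive_in O st ->
  recursive_in O (fun x => run (ans x) (t x) (st x)).
Proof.
  intros Hans Ht Hst.
  apply (rec_iter t (fun x => oracle_step (ans x)) st); trivial.
  now apply rec_oracle_step.
Qed.

End ComputableRun.

Lemma run_S ans t st : run ans (S t) st = run ans t (oracle_step ans st).
Proof. apply Nat.iter_succ_r. Qed.

Lemma run_add ans s t st : run ans (s + t) st = run ans t (run ans s st).
Proof. unfold run. rewrite Nat.add_comm. apply Nat.iter_add. Qed.

Lemma oracle_step_halted ans v : oracle_step ans (ret v 0) = ret v 0.
Proof. unfold oracle_step, step, ret. unpairs. reflexivity. Qed.

Lemma run_halted ans t v : run ans t (ret v 0) = ret v 0.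
Proof. induction t; [reflexivity|]. now rewrite run_S, oracle_step_halted. Qed.

Lemma run_mono ans s t st v :
  run ans s st = ret v 0 -> s <= t -> run ans t st = ret v 0.
Proof.
  intros H Hle. replace t with (s + (t - s)) by lia.
  now rewrite run_add, H, run_halted.
Qed.

Lemma oracle_step_ret ans v tag d k :
  oracle_step ans (ret v (push tag d k)) = frame_step tag d v k.
Proof.
  unfold oracle_step, step, ret, push. unpairs. cbn [Nat.eqb pred]. now unpairs.
Qed.

Lemma oracle_step_ev ans c x k : oracle_step ans (ev c x k) = eval_step (ans x) c x k.
Proof. unfold oracle_step, step, ev. now unpairs. Qed.

Lemma ev_not_halted c x k : ~ halted (ev c x k).
Proof. unfold halted, ev. unpairs. intros [H _]. discriminate. Qed.

Lemma ret_push_not_halted v tag d k : ~ halted (ret v (push tag d k)).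
Proof. unfold halted, ret, push. unpairs. intros [_ H]. discriminate. Qed.

(** * Correctness of the universal machine *)

Section Correctness.
Context (O : nat -> Prop) (ans : nat -> nat) (Hans : forall q, ans q = chi (O q)).

Lemma code_components c : c mod 9 <> 0 -> unpair1 (c / 9) < c /\ unpair2 (c / 9) < c.
Proof.
  intros H. assert (c <> 0) by (intros ->; now apply H).
  assert (c / 9 < c) by (apply Nat.div_lt; lia).
  pose proof (unpair_le (c / 9)). lia.
Qed.

Ltac mod9_cases c E :=
  pose proof (Nat.mod_upper_bound c 9 ltac:(lia)) as Hmod;
  destruct (c mod 9) as [|[|[|[|[|[|[|[|[|?]]]]]]]]] eqn:E; [..|lia].

(** The stack [k] is arbitrary, so the induction hypothesis covers subcomputations that run on top
    of pushed frames. *)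
Lemma eval_run c :
  forall x y k, eval O (prog_of c) x y -> exists t, run ans t (ev c x k) = ret y k.
Proof.
  induction c as [c IH] using lt_wf_ind. intros x y k H.
  pose proof (code_components c) as Hc. rewrite prog_of_unfold in H. cbv zeta in H.
  assert (Hstep : forall z k, oracle_step ans (ev c z k) = eval_step (ans z) c z k)
    by (intros; apply oracle_step_ev).
  unfold eval_step in Hstep.
  mod9_cases c E; cbn [Nat.eqb] in Hstep.
  - inversion H; subst. exists 1. now rewrite run_S, Hstep.
  - inversion H; subst. exists 1. now rewrite run_S, Hstep.
  - inversion H; subst. exists 1. now rewrite run_S, Hstep.
  - inversion H; subst. exists 1. now rewrite run_S, Hstep.
  - inversion H as [| | | |? ? ? a b Ha Hb| | | | | |]; subst.
    destruct (IH (unpair1 (c / 9)) ltac:(lia) x a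
                (push 0 (pair (unpair2 (c / 9)) x) k) Ha) as [t1 H1].
    destruct (IH (unpair2 (c / 9)) ltac:(lia) x b (push 1 a k) Hb) as [t2 H2].
    exists (S (t1 + S (t2 + 1))).
    rewrite run_S, Hstep, run_add, H1, run_S, oracle_step_ret.
    unfold frame_step; cbn [Nat.eqb]. unpairs.
    now rewrite run_add, H2, run_S, oracle_step_ret.
  - inversion H as [| | | | |? ? ? a ? Ha Hb| | | | |]; subst.
    destruct (IH (unpair2 (c / 9)) ltac:(lia) x a
                (push 2 (unpair1 (c / 9)) k) Ha) as [t1 H1].
    destruct (IH (unpair1 (c / 9)) ltac:(lia) a y k Hb) as [t2 H2].
    exists (S (t1 + S t2)).
    now rewrite run_S, Hstep, run_add, H1, run_S, oracle_step_ret.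
  - exists 1. rewrite run_S, Hstep, Hans.
    inversion H; subst; [rewrite chi_true|rewrite chi_false]; trivial.
  - rewrite <- (pair_unpair x) in *. revert y k H.
    induction (unpair2 x) as [|m IHm]; intros y k H; apply eval_rec_iff in H; unpairs.
    + destruct (IH (unpair1 (c / 9)) ltac:(lia) _ _ k H) as [t Ht].
      exists (S t). rewrite run_S, Hstep. now unpairs.
    + destruct H as (r & Hr & Hy).
      destruct (IHm r (push 3 (pair (unpair2 (c / 9)) (pair (unpair1 x) m)) k) Hr)
        as [t1 H1].
      destruct (IH (unpair2 (c / 9)) ltac:(lia) _ _ k Hy) as [t2 H2].
      exists (S (t1 + S t2)). rewrite run_S, Hstep. unpairs. cbn [Nat.eqb pred].
      rewrite run_add, H1, run_S, oracle_step_ret.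
      unfold frame_step; cbn [Nat.eqb]. now unpairs.
  - inversion H as [| | | | | | | | | |? ? ? H0 Hlt]; subst.
    (* The machine reaches each candidate up to the result of the search. *)
    assert (Hn : forall n, n <= y -> exists t, run ans t (ev c x k) =
      ev (unpair1 (c / 9)) (pair x n) (push 4 (pair (unpair1 (c / 9)) (pair x n)) k)).
    { induction n as [|n IHn]; intros Hn.
      - exists 1. now rewrite run_S, Hstep.
      - destruct IHn as [t1 H1]; [lia|]. destruct (Hlt n Hn) as [r Hr].
        destruct (IH (unpair1 (c / 9)) ltac:(lia) _ _
                    (push 4 (pair (unpair1 (c / 9)) (pair x n)) k) Hr) as [t2 H2].
        exists (t1 + (t2 + 1)).
        rewrite run_add, H1, run_add, H2, run_S, oracle_step_ret.
        unfold frame_step; cbn [Nat.eqb]. now unpairs. }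
    destruct (Hn y (le_n y)) as [t1 H1].
    destruct (IH (unpair1 (c / 9)) ltac:(lia) _ _
                (push 4 (pair (unpair1 (c / 9)) (pair x y)) k) H0) as [t2 H2].
    exists (t1 + (t2 + 1)).
    rewrite run_add, H1, run_add, H2, run_S, oracle_step_ret.
    unfold frame_step; cbn [Nat.eqb]. now unpairs.
Qed.

(** The induction is on the running time, since a recursion evaluates the same code [c] again. The
    bound [t' < t] allows the hypothesis to be applied once more to the rest of the run. *)
Lemma run_eval t :
  forall c x k, halted (run ans t (ev c x k)) ->
  exists y t', t' < t /\ run ans t (ev c x k) = run ans t' (ret y k) /\
               eval O (prog_of c) x y.
Proof.
  induction t as [t IH] using lt_wf_ind. intros c x k H.
  destruct t as [|t]; [now apply ev_not_halted in H|].
  (* A halted run cannot end with a frame on the stack, so it takes at least the step that pops the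
     frame. *)
  assert (Hret : forall s y tag d k', halted (run ans s (ret y (push tag d k'))) ->
    exists s', s = S s' /\
      run ans s (ret y (push tag d k')) = run ans s' (frame_step tag d y k')).
  { intros [|s] y tag d k' Hs; [now apply ret_push_not_halted in Hs|].
    exists s. now rewrite run_S, oracle_step_ret. }
  rewrite run_S, oracle_step_ev in *. rewrite prog_of_unfold. cbv zeta.
  unfold eval_step in *. mod9_cases c E; cbn [Nat.eqb] in *.
  - exists 0, t. repeat split; [lia|constructor].
  - exists (S x), t. repeat split; [lia|constructor].
  - exists (unpair1 x), t. repeat split; [lia|constructor].
  - exists (unpair2 x), t. repeat split; [lia|constructor].
  - destruct (IH t ltac:(lia) _ _ _ H) as (a & t1 & Ht1 & E1 & Ha).
    rewrite E1 in H |- *. destruct (Hret _ _ _ _ _ H) as (t2 & -> & E2).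
    rewrite E2 in H |- *. unfold frame_step in H |- *; cbn [Nat.eqb] in H |- *. unpairs.
    destruct (IH t2 ltac:(lia) _ _ _ H) as (b & t3 & Ht3 & E3 & Hb).
    rewrite E3 in H |- *. destruct (Hret _ _ _ _ _ H) as (t4 & -> & E4).
    rewrite E4. exists (pair a b), t4. repeat split; [lia|]. now constructor.
  - destruct (IH t ltac:(lia) _ _ _ H) as (a & t1 & Ht1 & E1 & Ha).
    rewrite E1 in H |- *. destruct (Hret _ _ _ _ _ H) as (t2 & -> & E2).
    rewrite E2 in H |- *. unfold frame_step in H |- *; cbn [Nat.eqb] in H |- *.
    destruct (IH t2 ltac:(lia) _ _ _ H) as (b & t3 & Ht3 & E3 & Hb).
    exists b, t3. repeat split; trivial; [lia|]. econstructor; eauto.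
  - exists (ans x), t. repeat split; [lia|]. rewrite Hans.
    destruct (chi_cases (O x)) as [[? ->]|[? ->]]; now constructor.
  - destruct (unpair2 x) as [|m] eqn:Em; cbn [Nat.eqb pred] in *.
    + destruct (IH t ltac:(lia) _ _ _ H) as (y & t1 & Ht1 & E1 & Hy).
      exists y, t1. repeat split; trivial; [lia|].
      apply eval_rec_iff. now rewrite Em.
    + destruct (IH t ltac:(lia) _ _ _ H) as (r & t1 & Ht1 & E1 & Hr).
      rewrite E1 in H |- *. destruct (Hret _ _ _ _ _ H) as (t2 & -> & E2).
      rewrite E2 in H |- *. unfold frame_step in H |- *; cbn [Nat.eqb] in H |- *. unpairs.
      destruct (IH t2 ltac:(lia) _ _ _ H) as (y & t3 & Ht3 & E3 & Hy).
      exists y, t3. repeat split; trivial; [lia|].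
      apply eval_rec_iff. rewrite Em. exists r. split; trivial.
      rewrite prog_of_unfold in Hr. cbv zeta in Hr. now rewrite E in Hr.
  - set (f := unpair1 (c / 9)) in *.
    (* Loop invariant of the search: all candidates below [n] have been rejected. The induction is
       on the remaining time [s]. *)
    assert (Hmu : forall n s, s <= t ->
      (forall m, m < n -> exists k, eval O (prog_of f) (pair x m) (S k)) ->
      halted (run ans s (ev f (pair x n) (push 4 (pair f (pair x n)) k))) ->
      exists y t', t' < s /\
        run ans s (ev f (pair x n) (push 4 (pair f (pair x n)) k)) = run ans t' (ret y k) /\
        eval O (PMu (prog_of f)) x y).
    { intros n s. revert n. induction s as [s IHs] using lt_wf_ind.
      intros n Hs Hlt Hh.
      destruct (IH s ltac:(lia) _ _ _ Hh) as (v & t1 & Ht1 & E1 & Hv).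
      rewrite E1 in Hh |- *. destruct (Hret _ _ _ _ _ Hh) as (t2 & -> & E2).
      rewrite E2 in Hh |- *. unfold frame_step in Hh |- *; cbn [Nat.eqb] in Hh |- *. unpairs.
      destruct v as [|v]; cbn [Nat.eqb] in Hh |- *.
      - exists n, t2. repeat split; [lia|]. now constructor.
      - destruct (IHs t2 ltac:(lia) (S n)) as (y & t3 & Ht3 & E3 & Hy); trivial; [lia| |].
        + intros m Hm. destruct (Nat.eq_dec m n) as [->|]; eauto. apply Hlt. lia.
        + exists y, t3. repeat split; trivial. lia. }
    destruct (Hmu 0 t) as (y & t' & Ht' & E' & Hy); trivial; [lia|].
    exists y, t'. repeat split; trivial. lia.
Qed.

Lemma run_spec c x y :
  eval O (prog_of c) x y <-> exists t, run ans t (ev c x 0) = ret y 0.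
Proof.
  split; [apply eval_run|]. intros [t Ht].
  destruct (run_eval t c x 0) as (y' & t' & _ & E & Hy).
  - rewrite Ht. unfold halted, ret. now unpairs.
  - rewrite E, run_halted in Ht. apply pair_inj in Ht as [_ [-> _]%pair_inj]. trivial.
Qed.

Lemma halted_spec c x :
  (exists y, eval O (prog_of c) x y) <-> exists t, halted (run ans t (ev c x 0)).
Proof.
  split.
  - intros [y [t Ht]%run_spec]. exists t. rewrite Ht. unfold halted, ret. now unpairs.
  - intros [t Ht]. destruct (run_eval t c x 0 Ht) as (y & _ & _ & _ & Hy). eauto.
Qed.

End Correctness.

Lemma halted_mono ans s t c x :
  halted (run ans s (ev c x 0)) -> s <= t -> halted (run ans t (ev c x 0)).
Proof.
  intros H Hle. destruct H as [H1 H2].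
  set (st := run ans s (ev c x 0)) in *.
  assert (E : st = ret (unpair1 (unpair2 st)) 0).
  { rewrite <- (pair_unpair st) at 1. rewrite <- (pair_unpair (unpair2 st)) at 1.
    now rewrite H1, H2. }
  rewrite (run_mono ans s t _ _ E Hle). unfold halted, ret. now unpairs.
Qed.

(** * The second jump is [Sigma_2] *)

Definition jump_stage (s q : nat) : nat := chi (halted (run (fun _ => 0) s (ev q q 0))).

Lemma jump_stage_lim q :
  exists s0, forall s, s0 <= s -> jump_stage s q = chi (jump empty_oracle q).
Proof.
  assert (Hans : forall q, 0 = chi (empty_oracle q)) by (intros; now rewrite chi_false).
  pose proof (halted_spec empty_oracle (fun _ => 0) Hans q q) as Hspec.
  unfold jump_stage.
  destruct (classic (jump empty_oracle q)) as [H|H].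
  - rewrite (chi_true _ H). destruct (proj1 Hspec H) as [s0 Hs0].
    exists s0. intros s Hs. apply chi_true. eapply halted_mono; eauto.
  - rewrite (chi_false _ H). exists 0. intros s _. apply chi_false.
    intros Hs. apply H, Hspec. eauto.
Qed.

(** A run of [t] steps uses at most [t] oracle answers, and each of them is correct from some stage
    on. *)
Lemma run_jump_stage_lim t st :
  exists s0, forall s, s0 <= s ->
    run (jump_stage s) t st = run (fun q => chi (jump empty_oracle q)) t st.
Proof.
  revert st. induction t as [|t IH]; intros st; [now exists 0|].
  destruct (IH (oracle_step (fun q => chi (jump empty_oracle q)) st)) as [s1 H1].
  destruct (jump_stage_lim (unpair1 (unpair2 st))) as [s2 H2].
  exists (s1 + s2). intros s Hs. rewrite !run_S.
  rewrite <- (H1 s) by lia. f_equal. unfold oracle_step. now rewrite H2 by lia.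
Qed.

Definition approx_halts (t s e : nat) : Prop := halted (run (jump_stage s) t (ev e e 0)).

Lemma dec_approx_halts : computable_pred
  (fun z => approx_halts (unpair1 z) (unpair1 (unpair2 z)) (unpair2 (unpair2 z))).
Proof.
  unfold computable_pred, approx_halts, halted.
  assert (Hrun : recursive_in empty_oracle (fun z =>
    run (jump_stage (unpair1 (unpair2 z))) (unpair1 z)
      (ev (unpair2 (unpair2 z)) (unpair2 (unpair2 z)) 0))).
  { apply (rec_run (fun z => jump_stage (unpair1 (unpair2 z))) unpair1
      (fun z => ev (unpair2 (unpair2 z)) (unpair2 (unpair2 z)) 0)).
    - apply (proj1 (dec_chi _)). unfold halted.
      assert (Hrun' : recursive_in empty_oracle (fun z =>
        run (fun _ => 0) (unpair1 (unpair2 (unpair1 z))) (ev (unpair2 z) (unpair2 z) 0))).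
      { apply (rec_run (fun _ _ => 0) (fun z => unpair1 (unpair2 (unpair1 z)))
          (fun z => ev (unpair2 z) (unpair2 z) 0)); [|rec_auto|apply rec_ev]; rec_auto. }
      apply dec_and; apply dec_eq; rec_auto.
    - rec_auto.
    - apply rec_ev; rec_auto. }
  apply dec_and; apply dec_eq; rec_auto.
Qed.

(** For fixed [t] the approximate runs stabilize to the true run with oracle [jump empty_oracle].
    Halting within [t] steps of the true run is thus halting at almost all stages, a Sigma_2 form of
    the second jump. *)
Lemma zero_dprime_iff e :
  zero_dprime e <-> exists t s0, forall s, s0 <= s -> approx_halts t s e.
Proof.
  unfold zero_dprime, jump at 1, phi.
  rewrite (halted_spec _ (fun q => chi (jump empty_oracle q)) (fun _ => eq_refl)).
  unfold approx_halts. split.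
  - intros [t Ht]. exists t. destruct (run_jump_stage_lim t (ev e e 0)) as [s0 Hs0].
    exists s0. intros s Hs. now rewrite Hs0.
  - intros (t & s1 & H). exists t.
    destruct (run_jump_stage_lim t (ev e e 0)) as [s0 Hs0].
    rewrite <- (Hs0 (s0 + s1)) by lia. apply H. lia.
Qed.

(** * Counting *)

Lemma count_S P n : count P (S n) = chi (P n) + count P n.
Proof. reflexivity. Qed.

Lemma count_mono P n m : n <= m -> count P n <= count P m.
Proof. induction 1; trivial. rewrite count_S. lia. Qed.

Lemma count_lt (P : nat -> Prop) n m : P n -> n < m -> count P n < count P m.
Proof.
  intros HP Hlt. apply Nat.lt_le_trans with (count P (S n)).
  - rewrite count_S, chi_true by trivial. lia.
  - now apply count_mono.
Qed.

Lemma count_injective (P : nat -> Prop) n m : P n -> P m -> count P n = count P m -> n = m.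
Proof.
  intros Hn Hm E. destruct (lt_eq_lt_dec n m) as [[H|]|H]; trivial.
  - pose proof (count_lt P n m Hn H). lia.
  - pose proof (count_lt P m n Hm H). lia.
Qed.

Lemma count_hit (P : nat -> Prop) j m : j < count P m -> exists z, P z /\ count P z = j.
Proof.
  induction m as [|m IH]; [cbn; lia|]. rewrite count_S. intros H.
  destruct (chi_cases (P m)) as [[HP E]|[HP E]]; rewrite E in H; [|auto].
  destruct (Nat.eq_dec j (count P m)) as [->|]; [eauto|]. apply IH. lia.
Qed.

Lemma count_remove (Q : nat -> Prop) a m :
  Q a -> a < m -> count Q m = S (count (fun z => Q z /\ z <> a) m).
Proof.
  intros Ha. assert (Hle : forall k, k <= a ->
    count (fun z => Q z /\ z <> a) k = count Q k).
  { induction k as [|k IH]; intros Hk; [reflexivity|].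
    rewrite !count_S, IH by lia. f_equal.
    destruct (chi_cases (Q k)) as [[HQ ->]|[HQ ->]];
      [apply chi_true|apply chi_false]; intuition lia. }
  induction m as [|m IH]; [lia|]. intros Hlt. rewrite !count_S.
  destruct (Nat.eq_dec a m) as [<-|Hne].
  - rewrite Hle, chi_true, (chi_false (Q a /\ a <> a)) by (trivial; tauto). lia.
  - rewrite IH by lia.
    destruct (chi_cases (Q m)) as [[HQ ->]|[HQ ->]];
      [rewrite chi_true|rewrite chi_false]; intuition lia.
Qed.

(** Pigeonhole principle by induction on [n]; [Q] varies because the image of the last element is
    removed from it. *)
Lemma count_le_of_injection (P : nat -> Prop) g n m :
  forall Q : nat -> Prop, (forall x, x < n -> P x -> Q (g x) /\ g x < m) ->
  (forall x y, P x -> P y -> g x = g y -> x = y) -> count P n <= count Q m.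
Proof.
  induction n as [|n IH]; intros Q Hg Hinj; [cbn; lia|].
  rewrite count_S. destruct (chi_cases (P n)) as [[HP ->]|[HP ->]].
  - destruct (Hg n) as [HQ Hlt]; [lia|trivial|].
    rewrite (count_remove Q (g n)) by trivial. apply le_n_S, IH; trivial.
    intros x Hx HPx. destruct (Hg x) as [HQx Hltx]; [lia|trivial|].
    repeat split; trivial. intros E. apply Hinj in E; trivial. lia.
  - apply IH; trivial. intros x Hx. apply Hg. lia.
Qed.

(** Each element of [P] has a label below [s] and no label is shared, so [P] is finite. Labels are
    given by a relation, which avoids choosing them. Most finiteness arguments below are
    instances. *)
Lemma bounded_of_injection (F : nat -> nat -> Prop) s :
  forall P : nat -> Prop, (forall r, P r -> exists c, c < s /\ F r c) ->
  (forall r r' c, P r -> P r' -> F r c -> F r' c -> r = r') ->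
  exists N, forall r, P r -> r < N.
Proof.
  induction s as [|s IH]; intros P HF Hinj.
  - exists 0. intros r Hr. destruct (HF r Hr) as (c & Hc & _). lia.
  - destruct (classic (exists r, P r /\ F r s)) as [(r0 & Hr0 & HF0)|Hno].
    + destruct (IH (fun r => P r /\ r <> r0)) as [N HN].
      * intros r [Hr Hne]. destruct (HF r Hr) as (c & Hc & HFc).
        exists c. split; trivial. destruct (Nat.eq_dec c s) as [->|]; [|lia].
        destruct Hne. eauto.
      * intros r r' c [Hr _] [Hr' _]. eauto.
      * exists (N + S r0). intros r Hr.
        destruct (Nat.eq_dec r r0) as [->|Hne]; [lia|].
        specialize (HN r (conj Hr Hne)). lia.
    + apply IH; trivial. intros r Hr. destruct (HF r Hr) as (c & Hc & HFc).
      exists c. split; trivial. destruct (Nat.eq_dec c s) as [->|]; [|lia].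
      destruct Hno. eauto.
Qed.

Lemma bounded_initial_image (h : nat -> nat) n : exists m, forall y, y < n -> h y < m.
Proof.
  induction n as [|n [m Hm]]; [exists 0; lia|].
  exists (m + S (h n)). intros y Hy.
  destruct (Nat.eq_dec y n) as [->|]; [lia|]. specialize (Hm y). lia.
Qed.

(** * Equivalence structures *)

Definition infinite_class (A : eq_struct) (x : nat) : Prop :=
  forall m, exists z, m <= z /\ rel A x z.

(** Finitely many classes would all meet some initial segment, so infinitude is expressed by
    infinite classes that avoid each initial segment. *)
Definition infinitely_many_infinite_classes (A : eq_struct) : Prop :=
  forall n, exists x, univ A x /\ (forall y, y < n -> ~ rel A y x) /\ infinite_class A x.

Definition class_larger (A : eq_struct) (x n : nat) : Prop :=
  exists m, n < count (rel A x) m.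

(** Comparison of cardinalities that treats finite and infinite classes alike. *)
Definition class_size_le (A : eq_struct) (x : nat) (B : eq_struct) (y : nat) : Prop :=
  forall n, class_larger A x n -> class_larger B y n.

Definition class_rep (A : eq_struct) (r : nat) : Prop :=
  univ A r /\ forall y, y < r -> ~ rel A y r.

Lemma infinite_class_larger A x n : infinite_class A x -> class_larger A x n.
Proof.
  intros H. induction n as [|n [m Hm]].
  - destruct (H 0) as (z & _ & Hz). exists (S z).
    pose proof (count_lt (rel A x) z (S z) Hz). lia.
  - destruct (H m) as (z & Hle & Hz). exists (S z).
    pose proof (count_lt (rel A x) z (S z) Hz).
    pose proof (count_mono (rel A x) m z Hle). lia.
Qed.

Lemma embedding_class_size A B h r :
  is_equiv_on (univ A) (rel A) -> embedding A B h -> univ A r ->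
  class_size_le A r B (h r).
Proof.
  intros (HU & _) (Hu & Hinj & Hrel) Hr n [m Hm].
  destruct (bounded_initial_image h m) as [m' Hm'].
  exists m'. eapply Nat.lt_le_trans; [exact Hm|].
  apply count_le_of_injection with h.
  - intros x Hx HP. split; [|auto]. apply Hrel; trivial. apply HU in HP. tauto.
  - intros x y Hx%HU Hy%HU. now apply Hinj.
Qed.

(** If the class of [h x] were bounded by [m], the values of [h] would label the class of [x]
    injectively by numbers below [m]. *)
Lemma embedding_infinite_class A B h x :
  is_equiv_on (univ A) (rel A) -> embedding A B h -> univ A x ->
  infinite_class A x -> infinite_class B (h x).
Proof.
  intros (HU & _) (Hu & Hinj & Hrel) Hx Hinf m. apply NNPP. intros Hno.
  destruct (bounded_of_injection (fun z c => h z = c) m (rel A x)) as [N HN].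
  - intros z Hz. exists (h z). split; trivial. apply Nat.nle_gt. intros Hle.
    apply Hno. exists (h z). split; trivial. apply Hrel; trivial. apply HU in Hz. tauto.
  - intros r r' c Hr%HU Hr'%HU <- E. symmetry in E. now apply Hinj.
  - destruct (Hinf N) as (z & Hle & Hz). apply HN in Hz. lia.
Qed.

Lemma class_rep_exists A x :
  is_equiv_on (univ A) (rel A) -> univ A x -> exists r, class_rep A r /\ rel A r x.
Proof.
  intros (HU & Hrefl & Hsym & Htrans) Hx.
  destruct (least_witness (fun y => rel A y x)) as (r & Hr & Hlt); [eauto|].
  exists r. repeat split; trivial.
  - apply HU in Hr. tauto.
  - intros y Hy Hyr. apply (Hlt y Hy). eauto.
Qed.

Lemma class_rep_unique A r r' :
  is_equiv_on (univ A) (rel A) -> class_rep A r -> class_rep A r' -> rel A r r' -> r = r'.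
Proof.
  intros (HU & Hrefl & Hsym & Htrans) [_ H] [_ H'] Hrr'.
  destruct (lt_eq_lt_dec r r') as [[Hlt|]|Hlt]; trivial.
  - now destruct (H' _ Hlt).
  - destruct (H _ Hlt). auto.
Qed.

(** Phrased so as to contradict the conclusion of [bounded_of_injection]. *)
Lemma infinite_class_reps_unbounded A N :
  is_equiv_on (univ A) (rel A) -> infinitely_many_infinite_classes A ->
  ~ forall r, class_rep A r /\ infinite_class A r -> r < N.
Proof.
  intros HA Hinf HN. pose proof HA as (_ & _ & _ & Htrans).
  destruct (Hinf N) as (x & Hx & Hnew & Hxinf).
  destruct (class_rep_exists A x HA Hx) as (r & Hr & Hrx).
  apply (Hnew r); trivial. apply HN. split; trivial. intros m.
  destruct (Hxinf m) as (z & Hz & Hxz). eauto.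
Qed.

(** If all infinite classes of [B] met the numbers below [n], then each infinite class of [A] could
    be labelled by such a number in the image class; distinct classes have distinct image classes,
    so there would be only finitely many. *)
Lemma infinitely_many_infinite_classes_embeds A B :
  is_equiv_on (univ A) (rel A) -> is_equiv_on (univ B) (rel B) -> embeds A B ->
  infinitely_many_infinite_classes A -> infinitely_many_infinite_classes B.
Proof.
  intros HA HB [h Hh] Hinf n. apply NNPP. intros Hno.
  pose proof HB as (_ & _ & HsymB & HtransB).
  destruct (bounded_of_injection (fun r c => rel B c (h r)) n
    (fun r => class_rep A r /\ infinite_class A r)) as [N HN].
  - intros r [[Hr _] Hr']. apply NNPP. intros H. apply Hno. exists (h r).
    split; [apply Hh; trivial|]. split; [|now apply embedding_infinite_class with A].
    intros y Hy Hyr. eauto.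
  - intros r r' c [Hr _] [Hr' _] Hc Hc'. apply (class_rep_unique A); trivial.
    apply Hh; [apply Hr|apply Hr'|]. eauto.
  - exact (infinite_class_reps_unbounded A N HA Hinf HN).
Qed.

Section DecStruct.
Context {O : nat -> Prop}.

Lemma dec_univ A f :
  computable_eq_struct A -> recursive_in O f -> computable_in O (fun x => univ A (f x)).
Proof.
  intros (_ & H & _) Hf. apply (dec_comp (univ A)); trivial. now apply dec_relativize.
Qed.

Lemma dec_rel A f g :
  computable_eq_struct A -> recursive_in O f -> recursive_in O g ->
  computable_in O (fun x => rel A (f x) (g x)).
Proof.
  intros (_ & _ & H) Hf Hg.
  apply dec_ext with (fun x => (fun n => rel A (unpair1 n) (unpair2 n)) (pair (f x) (g x))).
  - apply (dec_comp (fun n => rel A (unpair1 n) (unpair2 n))); [now apply dec_relativize|].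
    rec_auto.
  - intros x. now unpairs.
Qed.

End DecStruct.

Ltac rec_struct_auto :=
  repeat first
  [ match goal with
    | H : computable_eq_struct ?A |- computable_in _ (fun x => univ ?A _) =>
        apply (dec_univ A _ H)
    | H : computable_eq_struct ?A |- computable_in _ (fun x => rel ?A _ _) =>
        apply (dec_rel A _ _ H)
    end
  | rec_step ].

(** * Greedy construction of embeddings *)

Section Greedy.
Context (O : nat -> Prop) (B C : eq_struct) (t : nat -> nat)
  (good : nat -> nat -> Prop) (M : nat).
Context (HB : computable_eq_struct B) (HC : computable_eq_struct C).
Context (Ht : recursive_in O t)
  (Hgood : computable_in O (fun z => good (unpair1 z) (unpair2 z))).

(* Classes with [t r <> 0] are sent to the class of [pred (t r)]; the others get
   the class of [unpair1 u] for the first witness [u] of [good r u] that avoids all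
   classes used before. *)
Lemma greedy_embedding :
  (forall r, class_rep B r -> t r <> 0 ->
     univ C (pred (t r)) /\ pred (t r) <= M /\ class_size_le B r C (pred (t r))) ->
  (forall r r', class_rep B r -> class_rep B r' -> t r <> 0 -> t r' <> 0 ->
     rel C (pred (t r)) (pred (t r')) -> r = r') ->
  (forall r u, class_rep B r -> t r = 0 -> good r u ->
     univ C (unpair1 u) /\ class_size_le B r C (unpair1 u)) ->
  (forall r s, class_rep B r -> t r = 0 ->
     exists u, good r u /\ forall c, c < S s -> ~ rel C c (unpair1 u)) ->
  computes_embedding O B C.
Proof.
  intros Htab Htabinj Hsound Hex.
  pose proof HB as (HBeq & _). pose proof HC as (HCeq & _).
  pose proof HBeq as (HBU & HBrefl & HBsym & HBtrans).
  pose proof HCeq as (HCU & HCrefl & HCsym & HCtrans).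
  (* [rep x] is the least element of the class of [x]; the first disjunct makes the search total
     outside the universe. *)
  destruct (rec_mu (O := O) (fun x y => ~ univ B x \/ rel B y x)) as (rep & Hrep & Hrepspec).
  { rec_struct_auto. }
  { intros x. destruct (classic (univ B x)); [eauto|]. exists 0. now left. }
  assert (Hrel_rep : forall x, univ B x -> rel B (rep x) x).
  { intros x Hx. destruct (Hrepspec x) as [[H|H] _]; tauto. }
  assert (Hrep_rep : forall x, univ B x -> class_rep B (rep x)).
  { intros x Hx. split; [exact (proj1 (HBU _ _ (Hrel_rep x Hx)))|].
    intros y Hy Hyr. apply (proj2 (Hrepspec x) y Hy). right.
    eapply HBtrans; eauto. }
  (* At [pair r s], where [s] bounds the images used so far, the result [u] is both the witness for
     [r] and the next bound, as [unpair1 u <= u]. If [r] needs no fresh class, [u = s] will do. *)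
  destruct (rec_mu (O := O) (fun z u => unpair2 z <= u /\
    (~ (univ B (unpair1 z) /\ forall y, y < unpair1 z -> ~ rel B y (unpair1 z)) \/
     t (unpair1 z) <> 0 \/
     (good (unpair1 z) u /\ forall c, c < S (unpair2 z) -> ~ rel C c (unpair1 u)))))
    as (next & Hnext & Hnextspec).
  { assert (Hgood' : forall f g, recursive_in O f -> recursive_in O g ->
      computable_in O (fun x => good (f x) (g x))).
    { intros f g Hf Hg.
      apply dec_ext with (fun x => (fun z => good (unpair1 z) (unpair2 z)) (pair (f x) (g x))).
      - apply (dec_comp (fun z => good (unpair1 z) (unpair2 z))); rec_auto.
      - intros x. now unpairs. }
    repeat first [apply Hgood' | progress rec_struct_auto]. }
  { intros z. destruct (classic (class_rep B (unpair1 z) /\ t (unpair1 z) = 0)) as [[Hr Ht0]|H].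
    - destruct (Hex _ (unpair2 z) Hr Ht0) as (u & Hu & Hnew). exists u. split; [|tauto].
      destruct (Hsound _ _ Hr Ht0 Hu) as [HCu _].
      (* A witness below the bound would have [unpair1 u] among the numbers whose classes are
         avoided. *)
      pose proof (unpair_le u). apply Nat.nlt_ge. intros Hlt.
      apply (Hnew (unpair1 u)); [lia|auto].
    - exists (unpair2 z). split; trivial. unfold class_rep in H. tauto. }
  (* [sq r] bounds the images of all representatives below [r]; starting from [M] it bounds the
     tabulated images too. *)
  set (sq := fun n => nat_rect (fun _ => nat) M (fun m s => next (pair m s)) n).
  assert (Hsq : recursive_in O sq).
  { apply (rec_nat_rect (fun _ => M) (fun n => n) (fun _ m s => next (pair m s))); rec_auto. }
  assert (HsqS : forall n, sq n <= sq (S n)).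
  { intros n. destruct (Hnextspec (pair n (sq n))) as [[H _] _]. now unpairs. }
  assert (Hsqmono : forall m n, m <= n -> sq m <= sq n).
  { induction 1; trivial. eapply Nat.le_trans; eauto. }
  set (img := fun r => if t r =? 0 then unpair1 (sq (S r)) else pred (t r)).
  assert (Himg : recursive_in O img) by (unfold img; rec_auto).
  assert (Hfresh : forall r, class_rep B r -> t r = 0 ->
    univ C (img r) /\ class_size_le B r C (img r) /\ img r <= sq (S r) /\
    forall c, c <= sq r -> ~ rel C c (img r)).
  { intros r Hr Ht0. unfold img. rewrite Ht0. cbn [Nat.eqb].
    destruct (Hnextspec (pair r (sq r))) as [[_ H] _]. unpairs.
    change (next (pair r (sq r))) with (sq (S r)) in H.
    destruct H as [H|[H|[H Hnew]]]; [contradiction|contradiction|].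
    destruct (Hsound _ _ Hr Ht0 H). pose proof (unpair_le (sq (S r))).
    repeat split; trivial; [lia|]. intros c Hc. apply Hnew. lia. }
  assert (Himgtab : forall r, t r <> 0 -> img r = pred (t r)).
  { intros r Hr. unfold img. now apply Nat.eqb_neq in Hr as ->. }
  assert (Himgsize : forall r, class_rep B r ->
    univ C (img r) /\ class_size_le B r C (img r) /\ img r <= sq (S r)).
  { intros r Hr. destruct (Nat.eq_dec (t r) 0) as [Ht0|Ht0].
    - destruct (Hfresh r Hr Ht0); tauto.
    - rewrite Himgtab by trivial. destruct (Htab r Hr Ht0) as (H1 & H2 & H3).
      repeat split; trivial. apply Nat.le_trans with (sq 0); trivial. apply Hsqmono. lia. }
  (* If the later image is fresh, it avoids the earlier one. If only the earlier one is fresh, it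
     avoids everything up to [sq 0], hence the tabulated later one. Two tabulated images differ by
     hypothesis. *)
  assert (Himglt : forall r r', r < r' -> class_rep B r -> class_rep B r' ->
    ~ rel C (img r) (img r')).
  { intros r r' Hlt Hr Hr' Hrel.
    destruct (Nat.eq_dec (t r') 0) as [Ht0'|Ht0'].
    - destruct (Hfresh r' Hr' Ht0') as (_ & _ & _ & Hn). apply (Hn (img r)); trivial.
      apply Nat.le_trans with (sq (S r)); [now apply Himgsize|auto].
    - destruct (Nat.eq_dec (t r) 0) as [Ht0|Ht0].
      + destruct (Hfresh r Hr Ht0) as (_ & _ & _ & Hn). apply (Hn (img r')); [|auto].
        rewrite Himgtab by trivial. apply Nat.le_trans with (sq 0).
        * now apply Htab.
        * apply Hsqmono. lia.
      + rewrite !Himgtab in Hrel by trivial.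
        assert (r = r') by auto. lia. }
  assert (Himginj : forall r r', class_rep B r -> class_rep B r' ->
    rel C (img r) (img r') -> r = r').
  { intros r r' Hr Hr' Hrel. destruct (lt_eq_lt_dec r r') as [[H|]|H]; trivial.
    - now destruct (Himglt r r').
    - destruct (Himglt r' r); auto. }
  (* Within a class, [f] preserves the rank of an element, as measured by [count]; the size
     comparison guarantees an element of that rank. *)
  destruct (rec_mu (O := O) (fun x z => ~ univ B x \/
    (rel C (img (rep x)) z /\
     count (rel C (img (rep x))) z = count (rel B (rep x)) x))) as (f & Hf & Hfspec).
  { rec_struct_auto. }
  { intros x. destruct (classic (univ B x)) as [Hx|Hx]; [|now exists 0; left].
    destruct (Himgsize _ (Hrep_rep x Hx)) as (_ & Hle & _).
    destruct (Hle (count (rel B (rep x)) x)) as [m Hm].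
    - exists (S x). apply count_lt; auto.
    - destruct (count_hit _ _ _ Hm) as (z & Hz & E). eauto. }
  assert (Hfspec' : forall x, univ B x -> rel C (img (rep x)) (f x) /\
    count (rel C (img (rep x))) (f x) = count (rel B (rep x)) x).
  { intros x Hx. destruct (Hfspec x) as [[H|H] _]; tauto. }
  assert (Hrelrep : forall x y, univ B x -> univ B y ->
    rel C (f x) (f y) -> rep x = rep y).
  { intros x y Hx Hy Hxy. apply Himginj; auto.
    destruct (Hfspec' x Hx), (Hfspec' y Hy). eauto. }
  destruct Hf as [p Hp]. exists p, f. split; [|auto]. repeat split.
  - intros x Hx. destruct (Hfspec' x Hx) as [H _]. apply HCU in H. tauto.
  - intros x y Hx Hy E.
    assert (Er : rep x = rep y).
    { apply Hrelrep; trivial. rewrite E. apply HCrefl.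
      destruct (Hfspec' y Hy) as [H _]. apply HCU in H. tauto. }
    destruct (Hfspec' x Hx) as [_ Ex], (Hfspec' y Hy) as [_ Ey].
    apply (count_injective (rel B (rep x))); auto.
    + rewrite Er. auto.
    + rewrite <- Ex, Er, <- Ey, E. reflexivity.
  - intros Hxy. assert (Er : rep x = rep y).
    { apply (class_rep_unique B); auto. apply HBtrans with x; auto.
      apply HBtrans with y; auto. }
    destruct (Hfspec' x) as [Hx' _]; trivial. destruct (Hfspec' y) as [Hy' _]; trivial.
    rewrite Er in Hx'. eauto.
  - intros Hxy%Hrelrep; trivial. apply HBtrans with (rep x); auto. rewrite Hxy. auto.
Qed.

End Greedy.

(** * Embeddings computed by the second and the first jump *)

Lemma dec_infinite_class A :
  computable_eq_struct A -> computable_in zero_dprime (infinite_class A).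
Proof.
  intros HA.
  apply dec_ext with (fun x => ~ exists m, ~ exists z, m <= z /\ rel A x z).
  (* Each of the two existential quantifiers costs one jump. *)
  - apply dec_not, (dec_exists_jump _ (fun x m => ~ exists z, m <= z /\ rel A x z)), dec_not.
    apply (dec_exists_jump _ (fun w z => unpair2 w <= z /\ rel A (unpair1 w) z)).
    rec_struct_auto.
  - intros x. split.
    + intros H m. apply NNPP. eauto.
    + intros H [m Hm]. auto.
Qed.

(** Every class of [B], of whatever size, is sent to a fresh infinite class of [C]; the table is
    empty. *)
Lemma zero_dprime_computes_embedding B C :
  computable_eq_struct B -> computable_eq_struct C ->
  infinitely_many_infinite_classes C -> computes_embedding zero_dprime B C.
Proof.
  intros HB HC Hinf.
  apply (greedy_embedding zero_dprime B C (fun _ => 0)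
    (fun _ u => univ C (unpair1 u) /\ infinite_class C (unpair1 u)) 0); trivial.
  - rec_auto.
  - pose proof (dec_infinite_class C HC). rec_struct_auto.
  - tauto.
  - tauto.
  - intros r u _ _ [Hu Hui]. split; trivial. intros n _. now apply infinite_class_larger.
  - intros r s _ _. destruct (Hinf (S s)) as (x & Hx & Hnew & Hxi).
    exists (pair x 0). now unpairs.
Qed.

(** All but finitely many classes of [B] are finite with infinitely many classes of [C] at least as
    large; for these the first jump recognizes the last element, and the greedy search works. The
    exceptional classes are tabulated along [h]. *)
Lemma zero_prime_computes_embedding B C :
  computable_eq_struct B -> computable_eq_struct C -> embeds B C ->
  ~ infinitely_many_infinite_classes C -> computes_embedding (jump empty_oracle) B C.
Proof.
  intros HB HC [h Hh] Hfin.
  pose proof HB as (HBeq & _). pose proof HC as (HCeq & _).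
  pose proof HBeq as (HBU & HBrefl & HBsym & HBtrans).
  pose proof HCeq as (HCU & HCrefl & HCsym & HCtrans).
  set (plenty := fun n => forall s, exists c, univ C c /\ class_larger C c n /\
    forall c', c' < S s -> ~ rel C c' c).
  (* For the last element [m] of a class, [count (rel B r) m] is the size minus one; thus [plenty]
     of it provides infinitely many classes of at least the size of the given one. *)
  set (class_max := fun r m => rel B r m /\ ~ exists x, m < x /\ rel B r x).
  set (special := fun r => class_rep B r /\
    ~ exists m, class_max r m /\ plenty (count (rel B r) m)).
  assert (Hmax : forall r, ~ (exists m, class_max r m) -> univ B r -> infinite_class B r).
  { intros r Hno Hr m. induction m as [|m IH]; [exists r; split; [lia|auto]|].
    destruct IH as (z & Hz & Hrz). apply NNPP. intros H. apply Hno.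
    exists z. split; trivial. intros (x & Hx & Hrx). apply H.
    exists x. split; trivial. lia. }
  (* If every size is plentiful, special classes are infinite, and so are their images, all of which
     meet a fixed initial segment by [Hfin]. Otherwise take the least [n] that is not plentiful:
     special classes have more than [n] elements, hence so do their images, and almost all such
     classes are excluded. *)
  assert (Hcover : exists s, forall r, special r -> exists c, c < s /\ rel C c (h r)).
  { destruct (classic (forall n, plenty n)) as [Hall|Hnot].
    - apply not_all_ex_not in Hfin as [n Hn]. exists n. intros r [Hr Hsp].
      assert (Hinf : infinite_class C (h r)).
      { apply embedding_infinite_class with B; trivial; [apply Hr|].
        apply Hmax; [|apply Hr]. intros [m Hm]. apply Hsp. eauto. }
      apply NNPP. intros H. apply Hn. exists (h r).
      split; [apply Hh, Hr|]. split; trivial. intros y Hy Hyr. eauto.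
    - apply not_all_ex_not in Hnot. apply least_witness in Hnot as (n & Hn & Hlt).
      apply not_all_ex_not in Hn as [s Hs]. exists (S s). intros r [Hr Hsp].
      apply NNPP. intros H. apply Hs. exists (h r). split; [apply Hh, Hr|].
      split; [|intros c' Hc' Hrel; eauto].
      apply embedding_class_size with B; trivial; [apply Hr|].
      destruct (classic (exists m, class_max r m)) as [[m Hm]|Hno].
      + exists (S m). apply Nat.le_lt_trans with (count (rel B r) m).
        * apply Nat.nlt_ge. intros Hc. apply Hsp. exists m. split; trivial.
          apply NNPP. intros Hp. exact (Hlt _ Hc Hp).
        * apply count_lt; [apply Hm|lia].
      + apply infinite_class_larger, Hmax; trivial. apply Hr. }
  destruct Hcover as [s Hs].
  destruct (bounded_of_injection (fun r c => rel C c (h r)) s special) as [N HN]; trivial.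
  { intros r r' c [Hr _] [Hr' _] Hc Hc'. apply (class_rep_unique B); trivial.
    apply Hh; [apply Hr|apply Hr'|]. eauto. }
  destruct (bounded_initial_image h N) as [M HM].
  (* The successor keeps 0 free for the untabulated classes. Neither [special] nor [h] need be
     computable, but [t] vanishes from [N] on. *)
  set (t := fun r => chi (special r) * S (h r)).
  assert (Ht : forall r, special r /\ t r = S (h r) \/ ~ special r /\ t r = 0).
  { intros r. unfold t.
    destruct (chi_cases (special r)) as [[? ->]|[? ->]]; [left|right]; split; trivial; lia. }
  assert (Ht' : forall r, t r <> 0 -> special r /\ pred (t r) = h r).
  { intros r Hr. destruct (Ht r) as [[? ->]|[? ?]]; [auto|contradiction]. }
  (* A witness [u] codes a target [c], the last element [m] of the class of [r], and an element of
     the class of [c] with the rank of [m], which certifies that this class is large enough. *)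
  apply (greedy_embedding (jump empty_oracle) B C t (fun r u =>
    class_max r (unpair1 (unpair2 u)) /\ rel C (unpair1 u) (unpair2 (unpair2 u)) /\
    count (rel C (unpair1 u)) (unpair2 (unpair2 u)) =
    count (rel B r) (unpair1 (unpair2 u))) M); trivial.
  - apply rec_finite_support with N. intros r Hr.
    destruct (Ht r) as [[Hsp _]|[_ ?]]; trivial. apply HN in Hsp. lia.
  - unfold class_max.
    assert (Hex : computable_in (jump empty_oracle)
      (fun z => exists x, unpair1 (unpair2 (unpair2 z)) < x /\ rel B (unpair1 z) x)).
    { apply (dec_exists_jump _
        (fun z x => unpair1 (unpair2 (unpair2 z)) < x /\ rel B (unpair1 z) x)).
      rec_struct_auto. }
    apply dec_and; [apply dec_and; [|now apply dec_not]|]; rec_struct_auto.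
  - intros r Hr [Hsp ->]%Ht'. split; [apply Hh, Hr|]. split.
    + apply Nat.lt_le_incl, HM, HN, Hsp.
    + apply embedding_class_size; trivial. apply Hr.
  - intros r r' Hr Hr' [_ ->]%Ht' [_ ->]%Ht' Hrel. apply (class_rep_unique B); trivial.
    apply Hh; trivial; [apply Hr|apply Hr'].
  - intros r u Hr _ ((Hrm & Hmaxm) & Hrel & E). split; [apply HCU in Hrel; tauto|].
    set (m := unpair1 (unpair2 u)) in *. set (z := unpair2 (unpair2 u)) in *.
    intros n [k Hk]. exists (S z).
    rewrite count_S, chi_true, E by trivial.
    apply Nat.lt_le_trans with (count (rel B r) k); trivial.
    apply Nat.le_trans with (count (rel B r) (S m)).
    (* Past the last element [m] the count no longer grows. *)
    + destruct (le_lt_dec k (S m)) as [Hle|Hlt]; [now apply count_mono|].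
      clear Hk. induction k as [|k IH]; [lia|].
      rewrite (count_S _ k), chi_false by (intros H; apply Hmaxm; exists k; split; [lia|trivial]).
      destruct (Nat.eq_dec k (S m)) as [->|]; [lia|]. apply IH. lia.
    + rewrite count_S, chi_true by trivial. lia.
  - intros r s' Hr Ht0. destruct (Ht r) as [[_ ?]|[Hsp _]]; [lia|].
    assert (Hm : exists m, class_max r m /\ plenty (count (rel B r) m)).
    { apply NNPP. intros H. apply Hsp. split; trivial. }
    destruct Hm as (m & Hm & Hp). destruct (Hp s') as (c & Hc & [k Hk] & Hnew).
    destruct (count_hit _ _ _ Hk) as (z & Hz & E).
    exists (pair c (pair m z)). unpairs. tauto.
Qed.

(** * Coded sequences *)

(* Every number codes an infinite sequence that is eventually [0]; [0] codes the
   constant sequence. *)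
Definition tail (n s : nat) : nat := Nat.iter n unpair2 s.
Definition entry (s i : nat) : nat := unpair1 (tail i s).

Lemma tail_S n s : tail (S n) s = tail n (unpair2 s).
Proof. apply Nat.iter_succ_r. Qed.

Lemma entry_S s i : entry s (S i) = entry (unpair2 s) i.
Proof. unfold entry. now rewrite tail_S. Qed.

Lemma sequence_ext n :
  forall s s', tail n s = 0 -> tail n s' = 0 ->
  (forall i, i < n -> entry s i = entry s' i) -> s = s'.
Proof.
  induction n as [|n IH]; intros s s' H H' E; [cbn in *; congruence|].
  rewrite tail_S in H, H'.
  rewrite <- (pair_unpair s), <- (pair_unpair s'). f_equal.
  - apply (E 0). lia.
  - apply IH; trivial. intros i Hi. rewrite <- !entry_S. apply E. lia.
Qed.

Lemma sequence_exists n :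
  forall Q : nat -> nat -> Prop, (forall i, i < n -> exists v, Q i v) ->
  exists s, tail n s = 0 /\ forall i, i < n -> Q i (entry s i).
Proof.
  induction n as [|n IH]; intros Q HQ; [exists 0; split; [reflexivity|lia]|].
  destruct (HQ 0) as [v Hv]; [lia|].
  destruct (IH (fun i => Q (S i))) as (s & Hs & Hent).
  { intros i Hi. apply HQ. lia. }
  exists (pair v s). rewrite tail_S. unpairs. split; trivial.
  intros [|i] Hi.
  - unfold entry, tail. cbn. now unpairs.
  - rewrite entry_S. unpairs. apply Hent. lia.
Qed.

Lemma uniform_bound n (Q : nat -> nat -> Prop) :
  (forall i, i < n -> exists w, forall w', w <= w' -> Q i w') ->
  exists w, forall w', w <= w' -> forall i, i < n -> Q i w'.
Proof.
  induction n as [|n IH]; intros HQ; [exists 0; lia|].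
  destruct IH as [w1 H1]; [intros i Hi; apply HQ; lia|].
  destruct (HQ n) as [w2 H2]; [lia|].
  exists (w1 + w2). intros w' Hw' i Hi.
  destruct (Nat.eq_dec i n) as [->|]; [apply H2|apply H1]; lia.
Qed.

(** * Coding a [Pi_4] predicate into a structure *)

Section Coding.
Context (R : nat -> Prop) (HR : computable_pred R).

Definition matrix (x a b c d : nat) : Prop := R (pair x (pair a (pair b (pair c d)))).

Definition total_matrix (x a b : nat) : Prop := forall c, exists d, matrix x a b c d.

(* [v = <b, g>] is the unique witness for [exists b, total_matrix x i b]: [b] is least,
   and [g] codes, for all [j < b], the least [c] refuting [total_matrix x i j]. *)
Definition witness (x i v : nat) : Prop :=
  tail (unpair1 v) (unpair2 v) = 0 /\ total_matrix x i (unpair1 v) /\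
  forall j, j < unpair1 v ->
    (forall d, ~ matrix x i j (entry (unpair2 v) j) d) /\
    forall c, c < entry (unpair2 v) j -> exists d, matrix x i j c d.

(** The condition on [tail] makes the code of a sequence of length [n] canonical, so that uniqueness
    of witnesses gives uniqueness of [s]. *)
Definition path (x n s : nat) : Prop :=
  tail n s = 0 /\ forall i, i < n -> witness x i (entry s i).

(** Decidable approximation of the Pi_2 relation [path]: unbounded universal quantifiers are cut off
    at [k], existential ones at [w]. *)
Definition path_stage (x n s k w : nat) : Prop :=
  tail n s = 0 /\ forall i, i < n ->
    tail (unpair1 (entry s i)) (unpair2 (entry s i)) = 0 /\
    (forall c, c < k -> exists d, d < w /\ matrix x i (unpair1 (entry s i)) c d) /\
    forall j, j < unpair1 (entry s i) ->
      (forall d, d < k -> ~ matrix x i j (entry (unpair2 (entry s i)) j) d) /\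
      forall c, c < entry (unpair2 (entry s i)) j -> exists d, d < w /\ matrix x i j c d.

(* The element [<<n, s>, <k, w>>] lies in the class of [<n, s>] if it fires, and is
   a singleton otherwise. *)
Definition fires (x u : nat) : Prop :=
  path_stage x (unpair1 (unpair1 u)) (unpair2 (unpair1 u))
    (unpair1 (unpair2 u)) (unpair2 (unpair2 u)) /\
  forall w, w < unpair2 (unpair2 u) ->
    ~ path_stage x (unpair1 (unpair1 u)) (unpair2 (unpair1 u)) (unpair1 (unpair2 u)) w.

Definition coded (x : nat) : eq_struct :=
  EqStruct (fun _ => True)
    (fun u v => u = v \/ (unpair1 u = unpair1 v /\ fires x u /\ fires x v)).

Lemma coded_equiv x : is_equiv_on (univ (coded x)) (rel (coded x)).
Proof.
  repeat split; cbn; auto.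
  - intros u v. intuition auto.
  - intros u v w [->|(E & H1 & H2)] [->|(E' & H1' & H2')]; auto.
    right. rewrite E, E'. auto.
Qed.

Lemma dec_coded : computable_pred
  (fun z => rel (coded (unpair1 z)) (unpair1 (unpair2 z)) (unpair2 (unpair2 z))).
Proof.
  unfold computable_pred in *. unfold coded, fires, path_stage, matrix, entry, tail, rel.
  rec_auto.
Qed.

Lemma path_stage_mono x n s k w k' w' :
  path_stage x n s k w -> k' <= k -> w <= w' -> path_stage x n s k' w'.
Proof.
  intros [H0 H] Hk Hw. split; trivial. intros i Hi.
  destruct (H i Hi) as (H1 & H2 & H3). split; trivial. split.
  - intros c Hc. destruct (H2 c) as (d & Hd & Hm); [lia|]. exists d. split; trivial. lia.
  - intros j Hj. destruct (H3 j Hj) as [H4 H5]. split.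
    + intros d Hd. apply H4. lia.
    + intros c Hc. destruct (H5 c Hc) as (d & Hd & Hm). exists d. split; trivial. lia.
Qed.

(** For fixed [k] only finitely many existential quantifiers remain, so one [w] serves them all;
    conversely each universal instance is read off at a sufficiently large [k]. *)
Lemma path_stage_spec x n s :
  path x n s <-> forall k, exists w, path_stage x n s k w.
Proof.
  split.
  - intros [H0 H] k.
    destruct (uniform_bound n (fun i w =>
      (forall c, c < k -> exists d, d < w /\ matrix x i (unpair1 (entry s i)) c d) /\
      forall j, j < unpair1 (entry s i) ->
      forall c, c < entry (unpair2 (entry s i)) j ->
      exists d, d < w /\ matrix x i j c d)) as [w Hw].
    + intros i Hi. destruct (H i Hi) as (H1 & H2 & H3).
      destruct (uniform_bound k (fun c w =>
        exists d, d < w /\ matrix x i (unpair1 (entry s i)) c d)) as [w1 Hw1].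
      { intros c _. destruct (H2 c) as [d Hd]. exists (S d). intros w' Hw'. exists d.
        split; trivial. }
      destruct (uniform_bound (unpair1 (entry s i)) (fun j w =>
        forall c, c < entry (unpair2 (entry s i)) j ->
        exists d, d < w /\ matrix x i j c d)) as [w2 Hw2].
      { intros j Hj. apply uniform_bound. intros c Hc.
        destruct (H3 j Hj) as [_ H4]. destruct (H4 c Hc) as [d Hd].
        exists (S d). intros w' Hw'. exists d. split; trivial. }
      exists (w1 + w2). intros w' Hw'. split.
      * apply Hw1. lia.
      * apply Hw2. lia.
    + exists w. split; trivial. intros i Hi. destruct (H i Hi) as (H1 & H2 & H3).
      destruct (Hw w (le_n w) i Hi) as [H4 H5].
      split; trivial. split; trivial. intros j Hj. split; [|auto].
      intros d _. now apply H3.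
  - intros H. split; [now destruct (H 0) as (w & ? & _)|]. intros i Hi.
    assert (Hi' : forall k, exists w,
      tail (unpair1 (entry s i)) (unpair2 (entry s i)) = 0 /\
      (forall c, c < k -> exists d, d < w /\ matrix x i (unpair1 (entry s i)) c d) /\
      forall j, j < unpair1 (entry s i) ->
        (forall d, d < k -> ~ matrix x i j (entry (unpair2 (entry s i)) j) d) /\
        forall c, c < entry (unpair2 (entry s i)) j ->
        exists d, d < w /\ matrix x i j c d).
    { intros k. destruct (H k) as [w [_ Hw]]. exists w. now apply Hw. }
    split; [now destruct (Hi' 0) as (w & ? & _)|]. split.
    + intros c. destruct (Hi' (S c)) as (w & _ & Hw & _).
      destruct (Hw c) as (d & _ & Hd); eauto.
    + intros j Hj. split.
      * intros d. destruct (Hi' (S d)) as (w & _ & _ & Hw).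
        destruct (Hw j Hj) as [Hw' _]. apply Hw'. lia.
      * intros c Hc. destruct (Hi' 0) as (w & _ & _ & Hw).
        destruct (Hw j Hj) as [_ Hw']. destruct (Hw' c Hc) as (d & _ & Hd). eauto.
Qed.

(** A smaller first component in one witness would be refuted by the other. The first components
    therefore agree, and each entry is determined as a least refutation. *)
Lemma witness_unique x i v v' : witness x i v -> witness x i v' -> v = v'.
Proof.
  assert (Hle : forall v v', witness x i v -> witness x i v' -> unpair1 v' <= unpair1 v).
  { intros u u' (_ & H & _) (_ & _ & H'). apply Nat.nlt_ge. intros Hlt.
    destruct (H' _ Hlt) as [Hno _].
    destruct (H (entry (unpair2 u') (unpair1 u))) as [d Hd]. exact (Hno d Hd). }
  intros Hv Hv'. pose proof (Hle _ _ Hv Hv'). pose proof (Hle _ _ Hv' Hv).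
  assert (E : unpair1 v = unpair1 v') by lia.
  destruct Hv as (H1 & _ & H2), Hv' as (H1' & _ & H2').
  rewrite <- (pair_unpair v), <- (pair_unpair v'). f_equal; trivial.
  rewrite <- E in *. apply (sequence_ext (unpair1 v)); trivial.
  intros j Hj. destruct (H2 j Hj) as [Hn Hlt], (H2' j Hj) as [Hn' Hlt'].
  destruct (lt_eq_lt_dec (entry (unpair2 v) j) (entry (unpair2 v') j)) as [[Hc|]|Hc];
    trivial.
  - destruct (Hlt' _ Hc) as [d Hd]. now destruct (Hn d).
  - destruct (Hlt _ Hc) as [d Hd]. now destruct (Hn' d).
Qed.

Lemma path_unique x n s s' : path x n s -> path x n s' -> s = s'.
Proof.
  intros [H1 H2] [H1' H2']. apply (sequence_ext n); trivial.
  intros i Hi. apply (witness_unique x i); auto.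
Qed.

Lemma witness_exists x i : (exists b, total_matrix x i b) -> exists v, witness x i v.
Proof.
  intros (b & Hb & Hlt)%least_witness.
  destruct (sequence_exists b (fun j c => (forall d, ~ matrix x i j c d) /\
    forall c', c' < c -> exists d, matrix x i j c' d)) as (g & Hg & Hent).
  - intros j Hj. specialize (Hlt j Hj). apply not_all_ex_not in Hlt.
    destruct (least_witness _ Hlt) as (c & Hc & Hc').
    exists c. split; [now apply not_ex_all_not|]. intros c' Hc'c. now apply NNPP, Hc'.
  - exists (pair b g). unfold witness. unpairs. auto.
Qed.

(** Each [k] contributes the element with the least [w] for that stage, and these elements are
    unbounded. *)
Lemma path_infinite_class x n s :
  path x n s -> exists u, unpair1 u = pair n s /\ infinite_class (coded x) u.
Proof.
  intros Hp. assert (Hfire : forall k, exists w, fires x (pair (pair n s) (pair k w))).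
  { intros k. rewrite path_stage_spec in Hp.
    destruct (least_witness _ (Hp k)) as (w & Hw & Hmin). exists w.
    unfold fires. unpairs. auto. }
  destruct (Hfire 0) as [w0 Hw0]. exists (pair (pair n s) (pair 0 w0)). unpairs.
  split; trivial. intros m. destruct (Hfire m) as [w Hw].
  exists (pair (pair n s) (pair m w)). split.
  - pose proof (pair_ge (pair n s) (pair m w)). pose proof (pair_ge m w). lia.
  - right. unpairs. auto.
Qed.

(** If stage [k] is never reached, then by monotonicity no element of the class has its stage at or
    above [k]; minimality of [w] leaves at most one element per stage, so the class is finite. *)
Lemma infinite_class_path x u :
  infinite_class (coded x) u ->
  fires x u /\ path x (unpair1 (unpair1 u)) (unpair2 (unpair1 u)).
Proof.
  intros Hinf. assert (Hu : fires x u).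
  { destruct (Hinf (S u)) as (z & Hz & [->|(_ & H & _)]); [lia|trivial]. }
  split; trivial. apply path_stage_spec. intros k. apply NNPP. intros Hno.
  assert (Hall : forall z, rel (coded x) u z -> unpair1 u = unpair1 z /\ fires x z).
  { intros z [->|(E & _ & Hz)]; auto. }
  destruct (bounded_of_injection (fun z c => unpair1 (unpair2 z) = c) k
    (rel (coded x) u)) as [N HN].
  - intros z Hz%Hall. exists (unpair1 (unpair2 z)). split; trivial.
    apply Nat.nle_gt. intros Hle. apply Hno. destruct Hz as (E & [Hst _]).
    exists (unpair2 (unpair2 z)). rewrite E.
    eapply path_stage_mono; [exact Hst|exact Hle|trivial].
  - intros z z' c (E & Hz)%Hall (E' & Hz')%Hall Hc Hc'.
    destruct Hz as [Hz Hmin], Hz' as [Hz' Hmin'].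
    rewrite <- E in *. rewrite <- E' in *. rewrite Hc in *. rewrite Hc' in *.
    rewrite <- (pair_unpair z), <- (pair_unpair z'). f_equal; [congruence|].
    rewrite <- (pair_unpair (unpair2 z)), <- (pair_unpair (unpair2 z')).
    f_equal; [congruence|].
    destruct (lt_eq_lt_dec (unpair2 (unpair2 z)) (unpair2 (unpair2 z'))) as [[Hlt|]|Hlt];
      trivial.
    + now destruct (Hmin' _ Hlt).
    + now destruct (Hmin _ Hlt).
  - destruct (Hinf N) as (z & Hle & Hz). apply HN in Hz. lia.
Qed.

(** By [path_unique] there is at most one infinite class for each length. *)
Lemma same_length_related x u v :
  infinite_class (coded x) u -> infinite_class (coded x) v ->
  unpair1 (unpair1 u) = unpair1 (unpair1 v) -> rel (coded x) u v.
Proof.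
  intros [Hu Hpu]%infinite_class_path [Hv Hpv]%infinite_class_path E.
  right. split; [|auto]. rewrite <- (pair_unpair (unpair1 u)), <- (pair_unpair (unpair1 v)).
  f_equal; trivial. rewrite E in Hpu. exact (path_unique _ _ _ _ Hpu Hpv).
Qed.

(** If some [a] has no [b], paths have length at most [a], which leaves at most [S a] infinite
    classes. Otherwise there is a path of every length. *)
Lemma coded_infinitely_many_infinite_classes x :
  infinitely_many_infinite_classes (coded x) <-> forall a, exists b, total_matrix x a b.
Proof.
  split.
  - intros Hinf a. apply NNPP. intros Hno.
    destruct (bounded_of_injection (fun r c => unpair1 (unpair1 r) = c) (S a)
      (fun r => class_rep (coded x) r /\ infinite_class (coded x) r)) as [N HN].
    + intros r [_ [_ [_ Hr]]%infinite_class_path]. exists (unpair1 (unpair1 r)).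
      split; trivial. apply Nat.nle_gt. intros Hle. apply Hno.
      destruct (Hr a) as (_ & Ha & _); [lia|]. eauto.
    + intros r r' c [Hr Hri] [Hr' Hri'] E E'.
      apply (class_rep_unique (coded x)); trivial; [apply coded_equiv|].
      apply same_length_related; trivial. congruence.
    + exact (infinite_class_reps_unbounded _ _ (coded_equiv x) Hinf HN).
  - intros H n.
    destruct (sequence_exists n (witness x)) as (s & Hs).
    { intros i _. now apply witness_exists. }
    destruct (path_infinite_class x n s Hs) as (u & Eu & Hu).
    exists u. split; [exact I|]. split; trivial. intros y Hy Hyu.
    assert (E : unpair1 y = pair n s) by (destruct Hyu as [->|[-> _]]; trivial).
    (* Every element of this class codes [n], so it is not below [n]. *)
    pose proof (unpair_le y). pose proof (pair_ge n s). lia.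
Qed.

Lemma dec_coded_at {O} x : computable_in O
  (fun z => rel (coded x) (unpair1 z) (unpair2 z)).
Proof.
  apply dec_ext with (fun z => (fun z => rel (coded (unpair1 z))
    (unpair1 (unpair2 z)) (unpair2 (unpair2 z))) (pair x z)).
  - apply (dec_comp (fun z => rel (coded (unpair1 z))
      (unpair1 (unpair2 z)) (unpair2 (unpair2 z)))); [|rec_auto].
    apply dec_relativize, dec_coded.
  - intros z. now unpairs.
Qed.

Lemma coded_computable x : computable_eq_struct (coded x).
Proof.
  split; [apply coded_equiv|]. split; [apply dec_true|apply dec_coded_at].
Qed.

(** The index is that of a uniform decision program with [x] hard-wired. Extensionality turns
    agreement into equality of structures, which permits rewriting. *)
Lemma coded_index :
  exists f, computable_fun f /\ forall x,
    (forall u v, phi empty_oracle (f x) (pair u v) 0 \/ phi empty_oracle (f x) (pair u v) 1) /\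
    C_ (f x) = coded x.
Proof.
  destruct dec_coded as [q Hq].
  exists (fun x => code (PComp q (PPair (const_prog x) (PPair PFst PSnd)))). split.
  - change (recursive_in empty_oracle (fun x =>
      5 + 9 * pair (code q) (4 + 9 * pair (code (const_prog x)) (code (PPair PFst PSnd))))).
    rec_auto. apply rec_code_const_prog.
  - intros x. set (f := code (PComp q (PPair (const_prog x) (PPair PFst PSnd)))).
    assert (Hphi : forall u v,
      (rel (coded x) u v -> phi empty_oracle f (pair u v) 1) /\
      (~ rel (coded x) u v -> phi empty_oracle f (pair u v) 0)).
    { intros u v. specialize (Hq (pair x (pair u v))). unpairs.
      unfold phi, f. rewrite prog_of_code.
      assert (Ha : eval empty_oracle (PPair (const_prog x) (PPair PFst PSnd)) (pair u v)
        (pair x (pair u v))).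
      { constructor; [apply eval_const_prog|].
        rewrite <- (unpair1_pair u v) at 2. rewrite <- (unpair2_pair u v) at 3.
        repeat constructor. }
      split; intros H; econstructor; eauto; now apply Hq. }
    split.
    + intros u v. destruct (Hphi u v), (classic (rel (coded x) u v)); auto.
    + unfold C_, coded. f_equal. extensionality u. extensionality v.
      apply propositional_extensionality. destruct (Hphi u v) as [H1 H0]. split; [|apply H1].
      intros H. apply NNPP. intros Hno.
      pose proof (eval_det _ _ _ _ _ H (H0 Hno)). discriminate.
Qed.

End Coding.

(** * The lower bound on the degree *)

(** In [total_matrix], [v = 0] states that every candidate [c = <t, s0>] for [zero_dprime_iff] fails
    at some stage [d], while [v = S <t, s0>] states that this pair is correct, with [c] as the
    stage. *)
Definition zero_dprime_matrix (z : nat) : Prop :=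
  let e := unpair1 (unpair2 z) in
  let v := unpair1 (unpair2 (unpair2 z)) in
  let c := unpair1 (unpair2 (unpair2 (unpair2 z))) in
  let d := unpair2 (unpair2 (unpair2 (unpair2 z))) in
  (v = 0 /\ unpair2 c <= d /\ ~ approx_halts (unpair1 c) d e) \/
  (~ v = 0 /\ (unpair2 (pred v) <= c -> approx_halts (unpair1 (pred v)) c e)).

Lemma dec_zero_dprime_matrix : computable_pred zero_dprime_matrix.
Proof.
  assert (H : forall f g h, recursive_in empty_oracle f -> recursive_in empty_oracle g ->
    recursive_in empty_oracle h ->
    computable_in empty_oracle (fun z => approx_halts (f z) (g z) (h z))).
  { intros f g h Hf Hg Hh.
    apply dec_ext with (fun x => (fun z => approx_halts (unpair1 z) (unpair1 (unpair2 z))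
      (unpair2 (unpair2 z))) (pair (f x) (pair (g x) (h x)))).
    - apply (dec_comp (fun z => approx_halts (unpair1 z) (unpair1 (unpair2 z))
        (unpair2 (unpair2 z)))); [exact dec_approx_halts|rec_auto].
    - intros x. now unpairs. }
  unfold computable_pred, zero_dprime_matrix. cbv zeta.
  repeat first [apply H | rec_step].
Qed.

Lemma zero_dprime_matrix_0 x e :
  total_matrix zero_dprime_matrix x e 0 <-> ~ zero_dprime e.
Proof.
  rewrite zero_dprime_iff. unfold total_matrix, matrix, zero_dprime_matrix. split.
  - intros H (t & s0 & Hs). destruct (H (pair t s0)) as [d Hd]. unpairs.
    destruct Hd as [(_ & Hle & Hno)|[Hne _]]; [auto|now destruct Hne].
  - intros H c. apply NNPP. intros Hno. apply H. exists (unpair1 c), (unpair2 c).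
    intros s Hs. apply NNPP. intros Ha. apply Hno. exists s. unpairs. auto.
Qed.

Lemma zero_dprime_matrix_S x e v :
  total_matrix zero_dprime_matrix x e (S v) <->
  forall s, unpair2 v <= s -> approx_halts (unpair1 v) s e.
Proof.
  unfold total_matrix, matrix, zero_dprime_matrix. split.
  - intros H s Hs. destruct (H s) as [d Hd]. unpairs.
    destruct Hd as [(? & _)|[_ Hd]]; [discriminate|auto].
  - intros H c. exists 0. unpairs. right. split; [discriminate|apply H].
Qed.

Lemma zero_dprime_matrix_total x e : exists v, total_matrix zero_dprime_matrix x e v.
Proof.
  destruct (classic (zero_dprime e)) as [H|H].
  - apply zero_dprime_iff in H as (t & s0 & H). exists (S (pair t s0)).
    apply zero_dprime_matrix_S. now unpairs.
  - exists 0. now apply zero_dprime_matrix_0.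
Qed.

Lemma zero_dprime_matrix_decides x e v :
  total_matrix zero_dprime_matrix x e v -> (zero_dprime e <-> v <> 0).
Proof.
  destruct v as [|v].
  - rewrite zero_dprime_matrix_0. intuition.
  - rewrite zero_dprime_matrix_S, zero_dprime_iff. intros H. split; [discriminate|eauto].
Qed.

(** All classes are infinite and the numbers [pair i 0] list them computably, so an embedding of
    this structure lists distinct infinite classes of its target. *)
Definition standard : eq_struct :=
  EqStruct (fun _ => True) (fun x y => unpair1 x = unpair1 y).

Lemma standard_computable : computable_eq_struct standard.
Proof.
  repeat split; cbn; try congruence.
  - apply dec_true.
  - unfold computable_pred. rec_auto.
Qed.

Lemma standard_infinite_class x : infinite_class standard x.
Proof.
  intros m. exists (pair (unpair1 x) m). split; [apply pair_ge|]. cbn. now unpairs.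
Qed.

Lemma standard_infinitely_many_infinite_classes :
  infinitely_many_infinite_classes standard.
Proof.
  intros n. exists (pair n 0). split; [exact I|]. split; [|apply standard_infinite_class].
  intros y Hy E. cbn in E. unpairs. pose proof (unpair_le y). lia.
Qed.

Lemma computes_embedding_embeds O A B : computes_embedding O A B -> embeds A B.
Proof. intros (p & f & Hf & _). now exists f. Qed.

Lemma embedding_from_standard_computes_zero_dprime D :
  computes_embedding D standard (coded zero_dprime_matrix 0) -> turing_le zero_dprime D.
Proof.
  intros (p & f & Hf & Hp). set (K := coded zero_dprime_matrix 0) in *.
  assert (Hrec : recursive_in D f) by (exists p; intros x; now apply Hp).
  pose proof standard_computable as (Hstd & _).
  set (g := fun i => f (pair i 0)).
  assert (Hg : recursive_in D g) by (unfold g; rec_auto).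
  assert (Hinf : forall i, infinite_class K (g i)).
  { intros i. apply (embedding_infinite_class standard K f (pair i 0)); trivial;
      [exact I|apply standard_infinite_class]. }
  (* [i e] finds a listed infinite class whose path is longer than [e], so that the path has an
     entry for [e]; its first component then decides [zero_dprime e]. *)
  destruct (rec_mu (O := D) (fun e i => e < unpair1 (unpair1 (g i)))) as (i & Hi & Hispec).
  { rec_auto. }
  (* Otherwise the lengths, which are distinct for distinct infinite classes, would all be at most
     [e]. *)
  { intros e. apply NNPP. intros Hno.
    destruct (bounded_of_injection (fun i c => unpair1 (unpair1 (g i)) = c) (S e)
      (fun _ => True)) as [N HN].
    - intros i _. exists (unpair1 (unpair1 (g i))). split; trivial.
      apply Nat.nle_gt. intros Hle. apply Hno. exists i. lia.
    - intros i j c _ _ Ei Ej.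
      assert (Hrel : rel K (g i) (g j)).
      { apply same_length_related; trivial. congruence. }
      apply Hf in Hrel; [|exact I|exact I]. cbn in Hrel. now unpairs.
    - specialize (HN N I). lia. }
  apply dec_ext with
    (fun e => unpair1 (entry (unpair2 (unpair1 (g (i e)))) e) <> 0).
  - unfold entry, tail. rec_auto.
  - intros e. symmetry. apply (zero_dprime_matrix_decides 0).
    destruct (infinite_class_path _ _ _ (Hinf (i e))) as (_ & _ & Hpath).
    apply Hpath, Hispec.
Qed.

Lemma computable_C_ e :
  (forall x y, phi empty_oracle e (pair x y) 0 \/ phi empty_oracle e (pair x y) 1) ->
  is_equiv_on (univ (C_ e)) (rel (C_ e)) -> computable_eq_struct (C_ e).
Proof.
  intros Htot Heq. split; trivial. split; [apply dec_true|].
  exists (prog_of e). intros z. cbn. rewrite pair_unpair. split; trivial.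
  intros H. destruct (Htot (unpair1 z) (unpair2 z)) as [H'|H'];
    rewrite pair_unpair in H'; tauto.
Qed.

(** With finitely many infinite classes the same holds for all bi-embeddable copies, so the first
    jump suffices and leastness contradicts [jump_not_le]. With infinitely many, [standard] and the
    coded structure are both bi-embeddable with [A], so a suitable oracle computes an embedding of
    the former into the latter. *)
Lemma degree_zero_dprime_iff A :
  computable_eq_struct A ->
  (degree_bi_emb_cat A zero_dprime <-> infinitely_many_infinite_classes A).
Proof.
  intros HA. pose proof HA as (HAeq & _). split.
  - intros [_ Hleast]. apply NNPP. intros Hfin.
    apply (jump_not_le (jump empty_oracle)), Hleast.
    assert (Hnot : forall B, computable_eq_struct B -> bi_embeddable B A ->
      ~ infinitely_many_infinite_classes B).
    { intros B (HB & _) [HBA _] Hinf. apply Hfin.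
      now apply (infinitely_many_infinite_classes_embeds B A). }
    assert (Hcomp : forall B C, bi_embeddable B A -> bi_embeddable C A -> embeds B C).
    { intros B C [[f (Hf1 & Hf2 & Hf3)] _] [_ [g (Hg1 & Hg2 & Hg3)]].
      exists (fun x => g (f x)). split; [|split]; [auto|auto|].
      intros x y Hx Hy. rewrite Hf3, Hg3 by auto. tauto. }
    intros B C HB HC HBA HCA. split; apply zero_prime_computes_embedding; auto.
  - intros Hinf. split.
    + intros B C HB HC [_ HAB] [_ HAC].
      split; apply zero_dprime_computes_embedding; trivial.
      * apply (infinitely_many_infinite_classes_embeds A C); trivial. apply HC.
      * apply (infinitely_many_infinite_classes_embeds A B); trivial. apply HB.
    + intros D HD. apply embedding_from_standard_computes_zero_dprime.
      pose proof standard_computable as Hs.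
      pose proof (coded_computable _ dec_zero_dprime_matrix 0) as Hc.
      assert (Hci : infinitely_many_infinite_classes (coded zero_dprime_matrix 0)).
      { apply coded_infinitely_many_infinite_classes. intros a.
        apply zero_dprime_matrix_total. }
      assert (Hbi : forall B, computable_eq_struct B ->
        infinitely_many_infinite_classes B -> bi_embeddable B A).
      { intros B HB HBi.
        split; apply (computes_embedding_embeds zero_dprime);
          now apply zero_dprime_computes_embedding. }
      apply HD; auto. apply Hbi; trivial. apply standard_infinitely_many_infinite_classes.
Qed.

(** * The index set is [Pi_4] *)

Definition converges (t e x y : nat) : Prop :=
  run (fun _ => 0) t (ev e x 0) = ret y 0.

Lemma phi_converges e x y :
  phi empty_oracle e x y <-> exists t, converges t e x y.
Proof. apply run_spec. intros q. now rewrite chi_false. Qed.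

Lemma converges_mono t t' e x y : converges t e x y -> t <= t' -> converges t' e x y.
Proof. apply run_mono. Qed.

Lemma converges_det t t' e x y y' :
  converges t e x y -> converges t' e x y' -> y = y'.
Proof.
  intros H H'. apply (eval_det empty_oracle (prog_of e) x);
    apply phi_converges; eauto.
Qed.

(** Failure of the relation is expressed by convergence to 0, which keeps the matrix decidable; the
    second conjunct covers totality as well as symmetry. *)
Definition equiv_matrix (e x y z t : nat) : Prop :=
  converges t e (pair x x) 1 /\
  (converges t e (pair x y) 0 \/
   converges t e (pair x y) 1 /\ converges t e (pair y x) 1) /\
  (converges t e (pair x y) 0 \/ converges t e (pair y z) 0 \/
   converges t e (pair x z) 1).

Lemma equiv_matrix_spec e :
  (forall x y z, exists t, equiv_matrix e x y z t) <->
  (forall x y, phi empty_oracle e (pair x y) 0 \/ phi empty_oracle e (pair x y) 1) /\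
  is_equiv_on (univ (C_ e)) (rel (C_ e)).
Proof.
  split.
  - intros H.
    assert (Hno : forall t x y, rel (C_ e) x y -> ~ converges t e (pair x y) 0).
    { intros t x y [t' Ht']%phi_converges Ht.
      pose proof (converges_det _ _ _ _ _ _ Ht Ht'). discriminate. }
    split; [|repeat split].
    + intros x y. rewrite !phi_converges. destruct (H x y 0) as (t & _ & H2 & _).
      destruct H2 as [H2|[H2 _]]; eauto.
    + intros x _. destruct (H x x x) as (t & H1 & _). apply phi_converges. eauto.
    + intros x y Hxy. destruct (H x y 0) as (t & _ & H2 & _).
      destruct H2 as [H2|[_ H2]]; [now apply Hno in H2|]. apply phi_converges. eauto.
    + intros x y z Hxy Hyz. destruct (H x y z) as (t & _ & _ & H3).
      destruct H3 as [H3|[H3|H3]]; [now apply Hno in H3|now apply Hno in H3|].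
      apply phi_converges. eauto.
  - intros [Htot (_ & Hrefl & Hsym & Htrans)] x y z.
    assert (Hconv : forall u v, exists t, forall t', t <= t' ->
      rel (C_ e) u v /\ converges t' e (pair u v) 1 \/ converges t' e (pair u v) 0).
    { intros u v. destruct (Htot u v) as [H|H]; pose proof H as [t Ht]%phi_converges;
        exists t; intros t' Ht'; [right|left; split; trivial];
        now apply converges_mono with t. }
    assert (Hdet : forall t u v, rel (C_ e) u v -> ~ converges t e (pair u v) 0).
    { intros t u v [t' Ht']%phi_converges Ht.
      pose proof (converges_det _ _ _ _ _ _ Ht Ht'). discriminate. }
    destruct (Hconv x x) as [t1 H1], (Hconv x y) as [t2 H2], (Hconv y x) as [t3 H3],
      (Hconv y z) as [t4 H4], (Hconv x z) as [t5 H5].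
    (* Convergence persists, so the sum serves as a common time bound. *)
    exists (t1 + t2 + t3 + t4 + t5).
    specialize (H1 (t1 + t2 + t3 + t4 + t5) ltac:(lia)).
    specialize (H2 (t1 + t2 + t3 + t4 + t5) ltac:(lia)).
    specialize (H3 (t1 + t2 + t3 + t4 + t5) ltac:(lia)).
    specialize (H4 (t1 + t2 + t3 + t4 + t5) ltac:(lia)).
    specialize (H5 (t1 + t2 + t3 + t4 + t5) ltac:(lia)).
    split; [|split].
    + destruct H1 as [[_ H1]|H1]; trivial. apply Hdet in H1; [tauto|]. now apply Hrefl.
    + destruct H2 as [[H2 H2']|H2]; auto. right. split; trivial.
      destruct H3 as [[_ H3]|H3]; trivial. apply Hdet in H3; [tauto|]. auto.
    + destruct H2 as [[H2 H2']|H2]; auto. destruct H4 as [[H4 H4']|H4]; auto.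
      right. right. destruct H5 as [[_ H5]|H5]; trivial.
      apply Hdet in H5; [tauto|]. eauto.
Qed.

(** On a total index, avoiding the numbers below [a] is convergence to 0 and thus existential; it
    can share the innermost quantifier. *)
Definition infinite_matrix (e a b c z t : nat) : Prop :=
  c <= z /\ converges t e (pair b z) 1 /\
  forall y, y < a -> converges t e (pair y b) 0.

Lemma infinite_matrix_spec e :
  (forall x y, phi empty_oracle e (pair x y) 0 \/ phi empty_oracle e (pair x y) 1) ->
  (infinitely_many_infinite_classes (C_ e) <->
   forall a, exists b, forall c, exists z t, infinite_matrix e a b c z t).
Proof.
  intros Htot. split.
  - intros H a. destruct (H a) as (b & _ & Hnew & Hinf). exists b. intros c.
    destruct (Hinf c) as (z & Hz & Hbz). exists z.
    apply phi_converges in Hbz as [t1 Ht1].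
    destruct (uniform_bound a (fun y t => converges t e (pair y b) 0)) as [t2 Ht2].
    { intros y Hy. destruct (Htot y b) as [Hy0|Hy1]; [|now destruct (Hnew y Hy)].
      apply phi_converges in Hy0 as [t Ht]. exists t. intros t' Ht'.
      now apply converges_mono with t. }
    exists (t1 + t2). split; trivial. split.
    + apply converges_mono with t1; trivial. lia.
    + apply Ht2. lia.
  - intros H a. destruct (H a) as (b & Hb). exists b. split; [exact I|]. split.
    + intros y Hy [t Ht]%phi_converges. destruct (Hb 0) as (z & t' & _ & _ & H').
      pose proof (converges_det _ _ _ _ _ _ Ht (H' y Hy)). discriminate.
    + intros m. destruct (Hb m) as (z & t & Hz & Ht & _). exists z. split; trivial.
      apply phi_converges. eauto.
Qed.

Lemma index_set_iff e :
  index_set e <->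
  (forall x y z, exists t, equiv_matrix e x y z t) /\
  (forall a, exists b, forall c, exists z t, infinite_matrix e a b c z t).
Proof.
  rewrite equiv_matrix_spec. unfold index_set. split.
  - intros (Htot & HC & Hdeg). split.
    + split; trivial. apply HC.
    + apply infinite_matrix_spec; trivial. now apply degree_zero_dprime_iff.
  - intros ((Htot & Heq) & Hinf).
    pose proof (computable_C_ e Htot Heq) as HC.
    split; trivial. split; trivial.
    now apply degree_zero_dprime_iff, infinite_matrix_spec.
Qed.

(** The universal variable [c] does double duty: it is also read as the triple at which the
    equivalence axioms are tested. The variable [d] collects all existential witnesses. *)
Lemma index_set_Pi04 : Pi04 index_set.
Proof.
  exists (fun n =>
    let e := unpair1 n in
    let a := unpair1 (unpair2 n) in
    let b := unpair1 (unpair2 (unpair2 n)) in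
    let c := unpair1 (unpair2 (unpair2 (unpair2 n))) in
    let d := unpair2 (unpair2 (unpair2 (unpair2 n))) in
    equiv_matrix e (unpair1 c) (unpair1 (unpair2 c)) (unpair2 (unpair2 c)) (unpair1 d) /\
    infinite_matrix e a b c (unpair1 (unpair2 d)) (unpair2 (unpair2 d))).
  split.
  - cbv zeta. unfold computable_pred, equiv_matrix, infinite_matrix, converges.
    repeat first
      [ apply (rec_run (O := empty_oracle) (fun _ _ => 0))
      | apply rec_ev | apply rec_ret | rec_step ].
  - intros e. rewrite index_set_iff. cbv zeta. split.
    + intros [H1 H2] a. destruct (H2 a) as [b Hb]. exists b. intros c.
      destruct (Hb c) as (z & t & Hzt).
      destruct (H1 (unpair1 c) (unpair1 (unpair2 c)) (unpair2 (unpair2 c))) as [t' Ht'].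
      exists (pair t' (pair z t)). now unpairs.
    + intros H. split.
      * intros x y z. destruct (H 0) as [b Hb].
        destruct (Hb (pair x (pair y z))) as [d [Hd _]]. unpairs. eauto.
      * intros a. destruct (H a) as [b Hb]. exists b. intros c.
        destruct (Hb c) as [d [_ Hd]]. unpairs. eauto.
Qed.

(** For hardness, [x] is sent to an index of [coded R x]. This index is always total with a
    computable equivalence structure, so membership depends only on the number of infinite
    classes. *)
Theorem theorem4p6 : Pi04_complete index_set.
Proof.
  split; [apply index_set_Pi04|].
  intros T (R & HR & HT). destruct (coded_index R HR) as (f & Hf & Hfspec).
  exists f. split; trivial. intros x. destruct (Hfspec x) as [Htot E].
  rewrite HT.
  change (forall a, exists b, forall c, exists d, R (pair x (pair a (pair b (pair c d)))))
    with (forall a, exists b, total_matrix R x a b).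
  rewrite <- coded_infinitely_many_infinite_classes.
  unfold index_set. rewrite E, degree_zero_dprime_iff by now apply coded_computable.
  pose proof (coded_computable R HR x). tauto.
Qed.
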